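(* Let $S = A_7$ be the alternating group of degree $7$. Then the following hold. (a) $\sigma(S) = 2/5$, and for $s \in S^\times$ one has $\sigma(S,s) = 2/5$ exactly when $s$ has order $7$. (b) For $s \in S$ of order $7$, $\mathcal{M}(S,s)$ consists of two nonconjugate subgroups isomorphic to $L_2(7) = \mathrm{PSL}(2,7)$. (c) $P(S) = 2/5$, and for $s \in S^\times$ one has $P(S,s) = 2/5$ exactly when $s$ has order $7$. (d) The uniform spread of $S$ is exactly three, where the class can be taken to consist of elements $s$ of order $7$.
   Context: For a finite nonabelian simple group $S$ let $S^\times = S \setminus \{1\}$. For $s \in S^\times$, $\mathcal{M}(S,s)$ is the set of all maximal subgroups of $S$ containing $s$. For $M \le S$, $1_M^S$ is the permutation character of $S$ on the right cosets of $M$. For $g \in S^\times$ set $\sigma(g,s) = \sum_{M \in \mathcal{M}(S,s)} 1_M^S(g)/1_M^S(1)$, $\sigma(S,s) = \max\{\sigma(g,s) : g \in S^\times\}$, $\sigma(S) = \min\{\sigma(S,s) : s \in S^\times\}$. Further $P(g,s) = |\{h \in S : \langle s^h, g\rangle \neq S\}|/|S|$, $P(S,s) = \max\{P(g,s) : g \in S^\times\}$, $P(S) = \min\{P(S,s) : s \in S^\times\}$. $S$ has uniform spread at least $k$ if there is a fixed conjugacy class $C$ of $S$ such that for any $g_1,\ldots,g_k \in S^\times$ there is $s \in C$ with $\langle g_i, s\rangle = S$ for $1 \le i \le k$. The uniform spread is exactly $k$ if it is at least $k$ but not at least $k+1$. *)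

(* Defs.v *)
From HB Require Import structures.
From mathcomp Require Import all_boot all_order all_fingroup all_algebra.
From mathcomp Require Import all_solvable.

Set Implicit Arguments.
Unset Strict Implicit.
Unset Printing Implicit Defensive.

Import Order.TTheory GRing.Theory Num.Theory GroupScope.
Local Open Scope group_scope.

(* The fold starts from an actual value of f on A, so that for nonempty A these
   are the attained maximum and minimum; on the empty set they are 0. *)
Definition max_on (T : finType) (A : {set T}) (f : T -> rat) : rat :=
  let vals := [seq f x | x in A] in
  \big[Order.max/head 0%R vals]_(v <- vals) v.

Definition min_on (T : finType) (A : {set T}) (f : T -> rat) : rat :=
  let vals := [seq f x | x in A] in
  \big[Order.min/head 0%R vals]_(v <- vals) v.

Section UniformSpread.

Variables (gT : finGroupType) (S : {group gT}).
Implicit Types (g s : gT) (M : {group gT}) (C : {set gT}) (k : nat).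

Definition max_subgroups_containing s : {set {group gT}} :=
  [set M : {group gT} | maximal M S & s \in M].

Definition perm_char M g : nat := #|'Fix_(rcosets M S | 'Rs)[g]|.

Definition sigma_elt g s : rat :=
  (\sum_(M in max_subgroups_containing s)
     (perm_char M g)%:R / (perm_char M 1%g)%:R)%R.

Definition sigma_at s : rat := max_on S^# (fun g => sigma_elt g s).

Definition sigma_min : rat := min_on S^# sigma_at.

Definition P_elt g s : rat :=
  (#|[set h in S | <<[set s ^ h; g]>> != S]%g|%:R / #|S|%:R)%R.

Definition P_at s : rat := max_on S^# (fun g => P_elt g s).

Definition P_min : rat := min_on S^# P_at.

Definition spread_class C k : Prop :=
  forall g : 'I_k -> gT, (forall i, g i \in S^#) ->
  exists2 s, s \in C & forall i, <<[set g i; s]>> = S.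

Definition uniform_spread_ge k : Prop :=
  exists2 C, C \in classes S & spread_class C k.

Definition uniform_spread_eq k : Prop :=
  uniform_spread_ge k /\ ~ uniform_spread_ge k.+1.

End UniformSpread.

Section ProjectiveSpecialLinear.

Variables (n : nat) (F : finFieldType).

Definition SL : {set {'GL_n[F]}} :=
  [set u : {'GL_n[F]} | (\det (GLval u) == 1)%R].

Lemma SL_group_set : group_set SL.
Proof.
apply/group_setP; split=> [|u v]; first by rewrite inE GL_1E det1.
by rewrite !inE GL_ME det_mulmx => /eqP-> /eqP->; rewrite mul1r.
Qed.

Canonical SL_group := Group SL_group_set.

Definition PSL : {set coset_of 'Z(SL)} := SL / 'Z(SL).

Canonical PSL_group := [group of PSL].

End ProjectiveSpecialLinear.

(* Main.v *)
Require Import Defs.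
From HB Require Import structures.
From mathcomp Require Import all_boot all_order all_fingroup all_algebra.
From mathcomp Require Import all_solvable.
From mathcomp Require Import zify.

(** An element s of order 7 is a 7-cycle, and the proper subgroups of A7 that
    contain it lie in the stabilisers M1, M2 of the two Fano planes invariant
    under s: any g outside M1 and M2 yields short words in s, g of orders 3, 4
    and 5, so <s, g> has index at most 6 in the simple group A7.  The 15
    conjugates of M1 and the 15 conjugates of M2 behave like the points and
    the planes of PG(3,2); an element g <> 1 fixes at most 3 of each, whence
    sigma <= 2/5, and an involution attains the bound for P <= sigma.  An
    element of order other than 7 has a fixed point or two 2-cycles, and then
    the 3-cycles make P exceed 2/5.
    The 120 subgroups of order 7 correspond to antiflags, that is, to
    non-incident pairs (point, plane).  Three elements leave at least 6 points
    and 6 planes unfixed, among which there is an antiflag, while four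
    involutions whose axes belong to a spread of lines of PG(3,2) meet every
    antiflag. *)

(** * Computations on permutations coded as sequences *)

(** A permutation p of {0, ..., n-1} is coded by the sequence of its values;
    products are read from left to right, as in [perm]. *)
Definition mulseq (k l : seq nat) : seq nat := [seq nth 0 l i | i <- k].
Definition invseq (l : seq nat) : seq nat :=
  [seq index i l | i <- iota 0 (size l)].
Definition expseq (l : seq nat) k := iter k (mulseq l) (iota 0 (size l)).

(** The parity of the number of inversions: each entry is compared with the later ones. *)
Fixpoint odd_seq (l : seq nat) : bool :=
  if l is x :: l' then odd (count (fun y => y < x) l') (+) odd_seq l' else false.

Fixpoint perm_seqs n : seq (seq nat) :=
  if n is m.+1 then
    [seq x :: map (bump x) l | x <- iota 0 m.+1, l <- perm_seqs m]
  else [:: [::]].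

Definition is_perm_seq n l := (size l == n) && uniq l && all (fun x => x < n) l.

Definition even7 := [seq l <- perm_seqs 7 | ~~ odd_seq l].

(** The Steiner quasigroups of the two Fano planes invariant under the shift:
    row x, column y holds the third point of the line through x and y, and x
    itself on the diagonal.  The lines are the translates of {0, 2, 3} for
    [true] and of {0, 1, 3} for [false]. *)
Definition fano (b : bool) : seq (seq nat) :=
  if b then
    [:: [:: 0; 5; 3; 2; 6; 1; 4]; [:: 5; 1; 6; 4; 3; 0; 2];
        [:: 3; 6; 2; 0; 5; 4; 1]; [:: 2; 4; 0; 3; 1; 6; 5];
        [:: 6; 3; 5; 1; 4; 2; 0]; [:: 1; 0; 4; 6; 2; 5; 3];
        [:: 4; 2; 1; 5; 0; 3; 6]]
  else
    [:: [:: 0; 3; 6; 1; 5; 4; 2]; [:: 3; 1; 4; 0; 2; 6; 5];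
        [:: 6; 4; 2; 5; 1; 3; 0]; [:: 1; 0; 5; 3; 6; 2; 4];
        [:: 5; 2; 1; 6; 4; 0; 3]; [:: 4; 6; 3; 2; 0; 5; 1];
        [:: 2; 5; 0; 4; 3; 1; 6]].

Definition third b x y := nth 0 (nth [::] (fano b) x) y.

Definition fano_aut b (l : seq nat) :=
  all (fun x => all (fun y =>
    third b (nth 0 l x) (nth 0 l y) == nth 0 l (third b x y)) (iota 0 7))
    (iota 0 7).

Definition shift7 := [:: 1; 2; 3; 4; 5; 6; 0].

(** Representatives of the 15 right cosets of the stabiliser of [fano b]. *)
Definition fano_trans b : seq (seq nat) :=
  [:: [:: 0; 1; 2; 3; 4; 5; 6]; [:: 0; 1; 2; 3; 5; 6; 4];
      [:: 0; 1; 2; 3; 6; 4; 5]; [:: 0; 1; 2; 4; 3; 6; 5];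
      [:: 0; 1; 2; 4; 5; 3; 6]; [:: 0; 1; 2; 4; 6; 5; 3];
      [:: 0; 1; 2; 5; 3; 4; 6]; [:: 0; 1; 2; 5; 4; 6; 3];
      [:: 0; 1; 2; 5; 6; 3; 4]; [:: 0; 1; 2; 6; 3; 5; 4];
      [:: 0; 1; 2; 6; 4; 3; 5]; [:: 0; 1; 2; 6; 5; 4; 3]] ++
  if b then
    [:: [:: 0; 1; 3; 4; 6; 2; 5]; [:: 0; 1; 3; 5; 4; 2; 6];
        [:: 0; 1; 3; 6; 5; 2; 4]]
  else
    [:: [:: 0; 1; 3; 2; 4; 6; 5]; [:: 0; 1; 3; 2; 5; 4; 6];
        [:: 0; 1; 3; 2; 6; 5; 4]].

(** The code of g ^ h^-1. *)
Definition conjseq g h := mulseq h (mulseq g (invseq h)).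

Definition gen_words g :=
  let rot := [seq mulseq (expseq shift7 i) g | i <- iota 0 7] in
  let rot2 := [seq mulseq p q | p <- rot, q <- rot] in
  rot ++ rot2 ++ [seq mulseq p q | p <- rot, q <- rot2].

(** These test for an order divisible by 3, divisible by 4, and equal to 5. *)
Definition has_order3 l := (expseq l 6 == iota 0 7) && (expseq l 2 != iota 0 7).
Definition has_order4 l := (expseq l 4 == iota 0 7) && (expseq l 2 != iota 0 7).
Definition has_order5 l := (expseq l 5 == iota 0 7) && (expseq l 1 != iota 0 7).

Definition gen_check g :=
  let ws := gen_words g in
  [&& has has_order3 ws, has has_order4 ws & has has_order5 ws].

(** Only [g] fixing 0 are tested: multiplying [g] by a power of the shift [s] changes neither the
    group generated with [s] nor membership in the two stabilisers, which contain [s]. *)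
Lemma gen_checkP :
  all gen_check
    [seq g <- [seq g <- even7 | nth 0 g 0 == 0]
    | ~~ fano_aut true g && ~~ fano_aut false g].
Proof. by vm_compute. Qed.

(** A pair (a, b) stands for the set {a, b}, which is a single point if a = b. *)
Definition block_systems : seq (seq (nat * nat)) :=
  [seq [:: (a, a)] | a <- iota 0 7] ++
  [seq [:: e1; e2] | e1 <- [seq (a, b) | a <- iota 0 7, b <- iota a.+1 (6 - a)],
                     e2 <- [seq (c, d) | c <- iota e1.1.+1 (6 - e1.1),
                                         d <- [seq d <- iota c.+1 (6 - c) |
                                              (c != e1.2) && (d != e1.2)]]].

Definition swaps (l : seq nat) (e : nat * nat) :=
  (nth 0 l e.1 == e.2) && (nth 0 l e.2 == e.1).

Definition fixes (l : seq nat) (e : nat * nat) :=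
  (nth 0 l e.1 == e.1) && (nth 0 l e.2 == e.2).

(** The only even cycle types of degree 7 without fixed points are 7 and 3+2+2. The identity is
    listed apart because its seventh power is trivial although its order is not 7. *)
Lemma cycle_or_blocks :
  all (fun s => uniq (traject (nth 0 s) 0 7) && (expseq s 7 == iota 0 7) ||
    [&& (expseq s 7 != iota 0 7) || (s == iota 0 7)
      & has (all (swaps s)) block_systems]) even7.
Proof. by vm_compute. Qed.

Lemma block_systems_lt :
  all (all (fun e => (e.1 < 7) && (e.2 < 7))) block_systems.
Proof. by vm_compute. Qed.

(** The images under [h] of all blocks meet {0, 1, 2}, the support of a 3-cycle, for fewer than 1512
    = (3/5) 2520 elements [h]. For the others, some block is moved into the fixed points of the
    3-cycle. *)
Lemma count_blocks :
  all (fun bs => count (fun h => all (fun e =>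
     (nth 0 h e.1 < 3) || (nth 0 h e.2 < 3)) bs) even7 < 1512) block_systems.
Proof. by vm_compute. Qed.

Definition cycles3 : seq (seq nat) :=
  [:: [:: 1; 2; 0; 3; 4; 5; 6]; [:: 0; 1; 2; 4; 5; 3; 6];
      [:: 0; 1; 6; 2; 4; 5; 3]; [:: 1; 6; 2; 3; 4; 5; 0]].
(** The supports are {0,1,2}, {3,4,5}, {2,3,6} and {0,1,6}. The only 2-sets meeting all four are
    {0,3} and {1,3}, which are not disjoint; so of two disjoint 2-sets, one is fixed pointwise by
    some 3-cycle. *)
Lemma cycles3_blocks :
  all (fun bs => has (fun g => has (fixes g) bs) cycles3) block_systems.
Proof. by vm_compute. Qed.

Definition involutions : seq (seq nat) :=
  [:: [:: 0; 1; 2; 4; 3; 6; 5]; [:: 0; 1; 3; 2; 4; 6; 5];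
      [:: 0; 1; 3; 2; 5; 4; 6]; [:: 0; 1; 3; 2; 6; 5; 4]].

(** The antiflags are the pairs of cosets of M1 and M2 with a common element [h]; each has a point
    or a plane fixed by one of the four involutions. *)
Lemma involutions_cover :
  all (fun h => has (fun g => fano_aut true (conjseq g h) ||
      fano_aut false (conjseq g h)) involutions) even7.
Proof. by vm_compute. Qed.

(** The involution fixes 3 points and 3 planes, but no antiflag componentwise. Each coset has 168
    elements, so 6 * 168 = 1008 elements [h] satisfy the condition and 1512 remain. *)
Lemma count_involution :
  count (fun h => let g := conjseq [:: 0; 1; 2; 4; 3; 6; 5] h in
     ~~ (fano_aut true g || fano_aut false g)) even7 <= 1512.
Proof. by vm_compute. Qed.

(** [fano_aut b (conjseq g t)] says that [g] fixes the coset of [t], so this counts the fixed points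
    of [g] among the 15 cosets. *)
Lemma count_fano_fix b :
  all (fun g => (g == iota 0 7) ||
     (count (fun t => fano_aut b (conjseq g t)) (fano_trans b) <= 3)) even7.
Proof. by case: b; vm_compute. Qed.

Lemma fano_trans_cover b :
  all (fun h => has (fun t => fano_aut b (mulseq h (invseq t))) (fano_trans b)) even7.
Proof. by case: b; vm_compute. Qed.

Lemma count_fano_aut b : count (fano_aut b) even7 <= 168.
Proof. by case: b; vm_compute. Qed.

(** Coset representatives of M1 :&: M2, of order 21, in M1 := Aut (fano true).
    Since M1 :&: M2 has index 8, M1 t and M2 u form an antiflag iff they have
    a common element, and then M2 u meets one of these 8 translates of t. *)
Definition aut_reps : seq (seq nat) :=
  [:: [:: 0; 1; 2; 3; 4; 5; 6]; [:: 0; 1; 3; 2; 6; 5; 4];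
      [:: 0; 1; 4; 6; 2; 5; 3]; [:: 0; 1; 6; 4; 3; 5; 2];
      [:: 0; 2; 5; 1; 6; 3; 4]; [:: 0; 2; 6; 4; 5; 3; 1];
      [:: 0; 3; 4; 6; 5; 2; 1]; [:: 0; 3; 5; 1; 4; 2; 6]].

Definition antiflag t u :=
  has (fun m => fano_aut false (mulseq (mulseq m t) (invseq u))) aut_reps.

(** Two points of PG(3,2) lie on only 3 common planes. The bound 5 is one less than the number of
    planes that three elements are certain to leave unfixed. *)
Lemma antiflag_check :
  all (fun t1 => all (fun t2 => (t1 == t2) ||
    (count (fun u => ~~ (antiflag t1 u || antiflag t2 u)) (fano_trans false) <= 5))
    (fano_trans true)) (fano_trans true).
Proof. by vm_compute. Qed.

(** Both permutations belong to M2, so an element conjugating M2 to M1 would carry both into M1. *)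
Lemma not_conj_check :
  all (fun z => ~~ (fano_aut true (conjseq shift7 z) &&
     fano_aut true (conjseq [:: 0; 1; 4; 3; 2; 6; 5] z))) even7.
Proof. by vm_compute. Qed.

(** The words [word i], for i in F_7, are the indicators of the sets
    {(x : y) | y = 0 or x/y - i is a nonzero square} lifted to F_7^2 minus 0.
    SL(2,7) permutes them up to complement (they are, with their complements,
    the words of weight 4 of the extended quadratic residue code), which is
    its action on 7 points. *)
Definition vec7 : seq (nat * nat) :=
  [seq v <- [seq (x, y) | x <- iota 0 7, y <- iota 0 7] | v != (0, 0)].

Definition qr_word i (v : nat * nat) : bool :=
  if v.2 == 0 then true else (v.1 + (7 - i) * v.2) * v.2 %% 7 \in [:: 1; 2; 4].

(** The row vector v times the matrix with rows m.1 and m.2. *)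
Definition mulvec (v : nat * nat) (m : (nat * nat) * (nat * nat)) :=
  ((v.1 * m.1.1 %% 7 + v.2 * m.2.1 %% 7) %% 7,
   (v.1 * m.1.2 %% 7 + v.2 * m.2.2 %% 7) %% 7).

(** These are the elements of SL(2,7); the determinant condition is written additively because
    subtraction on [nat] truncates. *)
Definition mat7 : seq ((nat * nat) * (nat * nat)) :=
  [seq m <- [seq (r1, r2) | r1 <- [seq (x, y) | x <- iota 0 7, y <- iota 0 7],
                            r2 <- [seq (x, y) | x <- iota 0 7, y <- iota 0 7]]
   | m.1.1 * m.2.2 == m.1.2 * m.2.1 + 1 %[mod 7]].

Definition word i := [seq qr_word i v | v <- vec7].
Definition words := [seq word i | i <- iota 0 7].
Definition pull m j := [seq qr_word j (mulvec v m) | v <- vec7].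
Definition eq_compl (w w' : bitseq) := (w == w') || (w == map negb w').

(** The first half makes the action on words up to complement well defined; the second says that its
    kernel is {1, -1}, with -1 represented by 6. *)
Lemma sl2_check : all (fun m =>
   let ws := [seq pull m j | j <- iota 0 7] in
   all (fun w => has (eq_compl w) ws) words &&
   (all (fun i => eq_compl (nth [::] words i) (nth [::] ws i)) (iota 0 7) ==>
     ((m == ((1, 0), (0, 1))) || (m == ((6, 0), (0, 6)))))) mat7.
Proof. by vm_compute. Qed.

Lemma words_check :
  all (fun i => all (fun j => eq_compl (word i) (word j) ==> (i == j)) (iota 0 7))
    (iota 0 7).
Proof. by vm_compute. Qed.

Definition is_const (w : bitseq) := all id w || all negb w.

Definition sum3 i j k := [seq qr_word i v (+) qr_word j v (+) qr_word k v | v <- vec7].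

(** Modulo the constant words, the seven words are the nonzero vectors of a 3-dimensional space over
    F_2, and the lines are the triples with sum zero. The diagonal is apart: there the sum is the
    word itself. *)
Lemma lines_check :
  all (fun i => all (fun j => (i == j) && (third true i j == i) ||
     is_const (sum3 i j (third true i j)) && all (fun k => is_const (sum3 i j k) ==>
     (k == third true i j)) (iota 0 7)) (iota 0 7)) (iota 0 7).
Proof. by vm_compute. Qed.

(** Multiplication by 2 on F_7, induced by diag(3, 5); [weyl7] is induced by the Weyl element with
    rows (0, 1) and (-1, 0). *)
Definition double7 := [:: 0; 2; 4; 6; 1; 3; 5].
Definition weyl7 := [:: 0; 4; 2; 3; 1; 6; 5].

Definition borel_seqs :=
  [seq mulseq (expseq shift7 i) (expseq double7 k) | i <- iota 0 7, k <- iota 0 3].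
(** The Bruhat decomposition B + B w U of the group of order 168. *)
Definition bruhat_seqs :=
  borel_seqs ++ [seq mulseq (mulseq l weyl7) (expseq shift7 j)
                | l <- borel_seqs, j <- iota 0 7].

Lemma bruhat_check :
  all (fun l => l \in bruhat_seqs) [seq l <- even7 | fano_aut true l].
Proof. by vm_compute. Qed.

(** The full automorphism group of the plane is simple of order 168, so it has no subgroup of index
    2 and no odd element. *)
Lemma fano_even_check :
  all (fun l => ~~ fano_aut true l) [seq l <- perm_seqs 7 | odd_seq l].
Proof. by vm_compute. Qed.

(** A 7-cycle is its own centraliser in S7 up to powers, and doubling commutes with no nontrivial
    translation. *)
Lemma center_check : all (fun l =>
    (mulseq l shift7 == mulseq shift7 l) && (mulseq l double7 == mulseq double7 l)
    ==> (l == iota 0 7)) (perm_seqs 7).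
Proof. by vm_compute. Qed.

(** * Vectors and matrices over F_7 as pairs of numbers *)

Lemma mem_pair7 (w : nat * nat) :
  (w \in [seq (x, y) | x <- iota 0 7, y <- iota 0 7]) = (w.1 < 7) && (w.2 < 7).
Proof.
case: w => x y; apply/allpairsP/andP => [[p []] | [lt_x lt_y]].
  by rewrite !mem_iota => lt_x lt_y [-> ->].
by exists (x, y); rewrite !mem_iota.
Qed.

Lemma mem_vec7E w : (w \in vec7) = [&& w != (0, 0), w.1 < 7 & w.2 < 7].
Proof. by rewrite mem_filter mem_pair7. Qed.

Lemma mem_mat7E m :
  m.1.1 * m.2.2 = m.1.2 * m.2.1 + 1 %[mod 7] ->
  m.1.1 < 7 -> m.1.2 < 7 -> m.2.1 < 7 -> m.2.2 < 7 -> m \in mat7.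
Proof.
move=> detm lt11 lt12 lt21 lt22; rewrite mem_filter.
apply/andP; split; first by rewrite /= detm.
apply/allpairsP; exists m; split; first by rewrite mem_pair7 lt11.
  by rewrite mem_pair7 lt21.
exact: surjective_pairing.
Qed.

Definition twist_seq m (l : seq nat) :=
  all (fun i => eq_compl (word i) (pull m (nth 0 l i))) (iota 0 7).

Lemma twist_seq_shift7 : twist_seq ((1, 0), (1, 1)) shift7.
Proof. by vm_compute. Qed.

Lemma twist_seq_double7 : twist_seq ((3, 0), (0, 5)) double7.
Proof. by vm_compute. Qed.

Lemma twist_seq_weyl7 : twist_seq ((0, 1), (6, 0)) weyl7.
Proof. by vm_compute. Qed.

(** The map x -> -x interchanges the two planes: it sends {0, 2, 3} to {0, 5, 4}, a translate of {0,
    1, 3}. *)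
Lemma reflect_check :
  all (fun l => fano_aut true (conjseq l [:: 0; 6; 5; 4; 3; 2; 1]) == fano_aut false l)
    even7.
Proof. by vm_compute. Qed.

Import Order.TTheory GRing.Theory Num.Theory.
Import GroupScope.

(** * Permutations and their value sequences *)

Definition perm_seq n (p : 'S_n) : seq nat := [seq val (p i) | i <- enum 'I_n].
Lemma size_perm_seq n (p : 'S_n) : size (perm_seq n p) = n.
Proof. by rewrite size_map size_enum_ord. Qed.

Lemma nth_perm_seq n (p : 'S_n) (i : 'I_n) : nth 0 (perm_seq n p) i = p i.
Proof.
by rewrite (nth_map i) ?size_enum_ord // nth_ord_enum.
Qed.

Lemma perm_seq_inj n : injective (perm_seq n).
Proof.
move=> p q eqpq; apply/permP=> i; apply: val_inj => /=.
by rewrite -!nth_perm_seq eqpq.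
Qed.

Lemma perm_seq1 n : perm_seq n 1 = iota 0 n.
Proof. by rewrite -val_enum_ord; apply: eq_map => i; rewrite perm1. Qed.

Lemma perm_seqM n (p q : 'S_n) :
  perm_seq n (p * q) = mulseq (perm_seq n p) (perm_seq n q).
Proof.
rewrite /mulseq -map_comp; apply: eq_map => i /=.
by rewrite permM nth_perm_seq.
Qed.

Lemma perm_seqX n (p : 'S_n) k : perm_seq n (p ^+ k) = expseq (perm_seq n p) k.
Proof.
elim: k => [|k IHk]; first by rewrite perm_seq1 /expseq size_perm_seq.
by rewrite expgS perm_seqM IHk.
Qed.

Lemma perm_seqV n (p : 'S_n) : perm_seq n p^-1 = invseq (perm_seq n p).
Proof.
rewrite /invseq size_perm_seq -val_enum_ord -map_comp.
apply: eq_map => i /=; rewrite /perm_seq -[in RHS](permKV p i).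
rewrite (@index_map _ _ (fun k => val (p k))) ?index_enum_ord //.
by move=> x y /val_inj/perm_inj.
Qed.

Lemma lift_permP n (p : 'S_n.+1) : exists q, p = lift_perm ord0 (p ord0) q.
Proof.
pose f (k : 'I_n) := odflt k (unlift (p ord0) (p (lift ord0 k))).
have fK k : lift (p ord0) (f k) = p (lift ord0 k).
  rewrite /f; case: unliftP => [j -> //|/perm_inj/eqP].
  by rewrite eq_sym (negPf (neq_lift _ _)).
have f_inj : injective f.
  by move=> x y /(congr1 (lift (p ord0))); rewrite !fK => /perm_inj/lift_inj.
exists (perm f_inj); apply/permP=> i.
by case: (unliftP ord0 i) => [j|] ->; rewrite ?lift_perm_id // lift_perm_lift permE.
Qed.

Lemma perm_seq_lift n (j : 'I_n.+1) (q : 'S_n) :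
  perm_seq _ (lift_perm ord0 j q) = val j :: map (bump j) (perm_seq _ q).
Proof.
rewrite /perm_seq enum_ordSl /= lift_perm_id -!map_comp; congr (_ :: _).
by apply: eq_map => i /=; rewrite lift_perm_lift.
Qed.

Lemma mem_perm_seqs n (p : 'S_n) : perm_seq n p \in perm_seqs n.
Proof.
elim: n p => [|n IHn] p; first by rewrite /perm_seq enum_ord0.
have [q ->] := lift_permP _ p; rewrite perm_seq_lift.
apply/allpairsPdep; exists (val (p ord0)), (perm_seq n q); split=> //.
by rewrite mem_iota add0n ltn_ord.
Qed.

Lemma perm_seq_iota n (p : 'S_n) : perm_eq (perm_seq n p) (iota 0 n).
Proof.
apply: uniq_perm; rewrite ?iota_uniq //.
  by rewrite map_inj_uniq ?enum_uniq // => i j /val_inj/perm_inj.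
move=> i; rewrite mem_iota add0n leq0n /=; apply/mapP/idP => [[j _ ->]|lt_in].
  exact: ltn_ord.
by exists (p^-1 (Ordinal lt_in)); rewrite ?mem_enum // permKV.
Qed.

Lemma odd_seq_bump j l : odd_seq (map (bump j) l) = odd_seq l.
Proof.
elim: l => //= x l ->; congr (odd _ (+) _); rewrite count_map.
by apply: eq_count => y /=; rewrite !ltnNge leq_bump2.
Qed.

(** By induction: a first value [j] exceeds exactly [j] later values, and [odd_lift_perm] adds the
    same parity. *)
Lemma odd_perm_seq n (p : 'S_n) : p = odd_seq (perm_seq n p) :> bool.
Proof.
elim: n p => [|n IHn] p.
  by rewrite permS0 odd_perm1 /perm_seq enum_ord0.
have [q Dp] := lift_permP _ p; rewrite {}Dp; set j := p ord0.
rewrite perm_seq_lift odd_lift_perm /= odd_seq_bump IHn; congr (_ (+) _).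
rewrite count_map (@eq_count _ _ (fun y => y < j)); last first.
  by move=> y; rewrite /= /bump; case: (leqP j y) => /=; lia.
have /seq.permP-> := perm_seq_iota n q.
have le_jn : j <= n by rewrite -ltnS.
rewrite -[X in iota 0 X](subnKC le_jn) iotaD count_cat add0n.
rewrite (eq_in_count (a2 := predT)); last by move=> y; rewrite mem_iota.
rewrite count_predT size_iota (eq_in_count (a2 := pred0)) ?count_pred0 ?addn0 //.
by move=> y; rewrite mem_iota /=; lia.
Qed.

(** Meaningful only under [is_perm_seq n.+1 l], because of [inord]. *)
Definition seq_perm n (l : seq nat) : 'S_n.+1 :=
  insubd (1 : 'S_n.+1) [ffun i : 'I_n.+1 => inord (nth 0 l i)].

Lemma seq_permK n l : is_perm_seq n.+1 l -> perm_seq _ (seq_perm n l) = l.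
Proof.
case/andP=> /andP[/eqP size_l uniq_l] /allP lt_l.
have nthK (i : 'I_n.+1) : (inord (nth 0 l i) : 'I_n.+1) = nth 0 l i :> nat.
  by apply: inordK; apply: lt_l; rewrite mem_nth ?size_l.
have inj_l : injectiveb [ffun i : 'I_n.+1 => inord (nth 0 l i) : 'I_n.+1].
  apply/injectiveP => i j; rewrite !ffunE => /(congr1 val)/=; rewrite !nthK.
  by move/eqP; rewrite nth_uniq ?size_l // => /eqP/val_inj.
apply: (@eq_from_nth _ 0) => [|i]; rewrite size_perm_seq ?size_l // => lt_in.
rewrite (nth_perm_seq _ _ (Ordinal lt_in)) /= -[RHS](nthK (Ordinal lt_in)).
by rewrite -pvalE -[pval _]/(val _) /seq_perm insubdK ?ffunE.
Qed.

(** * Fixed point ratios and generation in a finite group *)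

Lemma max_on_ge (T : finType) (A : {set T}) f x :
  x \in A -> (f x <= max_on A f)%R.
Proof.
move=> Ax; rewrite /max_on; set vals := [seq f y | y in A].
by apply: le_bigmax_seq => //; apply: map_f; rewrite mem_enum.
Qed.

Lemma max_on_mem (T : finType) (A : {set T}) f :
  A != set0 -> exists2 x, x \in A & max_on A f = f x.
Proof.
case/set0Pn=> x0 Ax0; rewrite /max_on; set vals := [seq f y | y in A].
suff /imageP[x Ax ->]: (\big[Order.max/head 0%R vals]_(v <- vals) v) \in vals.
  by exists x.
have: f x0 \in vals by apply: map_f; rewrite mem_enum.
case: vals => // v vs _; rewrite /= big_seq.
elim/big_ind: _ => [|a b Va Vb|a //]; first exact: mem_head.
by case: leP.
Qed.

Lemma max_on_le (T : finType) (A : {set T}) f b :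
  A != set0 -> (forall x, x \in A -> (f x <= b)%R) -> (max_on A f <= b)%R.
Proof. by move=> /max_on_mem-/(_ f)[x Ax ->]; apply. Qed.

Lemma min_on_eq (T : finType) (A : {set T}) f x :
  x \in A -> (forall y, y \in A -> (f x <= f y)%R) -> min_on A f = f x.
Proof.
move=> Ax min_x; rewrite /min_on; set vals := [seq f y | y in A].
have Vx: f x \in vals by apply: map_f; rewrite mem_enum.
have minV v : v \in vals -> (f x <= v)%R by case/imageP=> y Ay ->; apply: min_x.
apply/le_anti/andP; split; first exact: ge_bigmin_seq.
rewrite big_seq; elim/big_ind: _ => [|a b Ha Hb|a /minV //].
  by apply: minV; case: vals Vx => // v vs _; apply: mem_head.
by rewrite le_min Ha.
Qed.

(** The core of [H] is normal and proper, hence trivial, so [G] embeds in the symmetric group on the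
    cosets of [H]. *)
Lemma card_simple_leq_index (gT : finGroupType) (G H : {group gT}) :
  simple G -> H \proper G -> #|G| <= #|G : H|`!.
Proof.
move=> simG /andP[sHG not_sGH].
have faithG : [faithful G, on rcosets H G | 'Rs].
  rewrite /faithful astabRs_rcosets.
  have [_ /(_ (gcore H G)%G (gcore_normal sHG))[-> | eqG]] := simpleP _ simG.
    exact: subsetIr.
  case/negP: not_sGH; apply: subset_trans (gcore_sub H G).
  by have -> : gcore H G = G := eqG.
have /isomP[inj_f _] := faithful_isom (actsRs_rcosets H G) faithG.
rewrite -(card_injm inj_f) // -card_perm.
apply/subset_leq_card/subsetP=> _ /morphimP[x Gx _ ->].
rewrite unfold_in; apply/subsetP=> X; rewrite unfold_in; apply: contraR => notRX.
by rewrite actpermE /= /actby /= (negPf notRX).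
Qed.

Section Probabilistic.

Variables (gT : finGroupType) (S : {group gT}).
Implicit Types (g s x : gT) (M : {group gT}).

(** [g] fixes the coset [M :* h] iff [g] lies in [M :^ h], so the set on the left is the disjoint
    union of the fixed cosets. *)
Lemma card_conj_contains M g :
  M \subset S -> g \in S ->
  #|[set h in S | g \in M :^ h]| = (perm_char S M g * #|M|)%N.
Proof.
move=> sMS Sg; rewrite /perm_char; set F := 'Fix_(_ | _)[g].
have sFR : F \subset rcosets M S by apply: subsetIl.
have trivF : trivIset F.
  have /and3P[_ trivR _] := rcosets_partition sMS.
  exact: trivIsetS sFR trivR.
have coverF : cover F = [set h in S | g \in M :^ h].
  have fixE h : (M :* h :* g == M :* h) = (g \in M :^ h).
    rewrite -rcosetM (sameP eqP rcoset_eqP) mem_rcoset mem_conjg conjgE invgK.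
    by rewrite mulgA.
  apply/setP=> h; rewrite inE; apply/bigcupP/andP=> [[X] | [Sh Mgh]].
    case/setIP=> /rcosetsP[x Sx ->] /afix1P/= fixX Xh.
    have DX : M :* x = M :* h by apply/rcoset_eqP; rewrite rcoset_sym.
    split; last by rewrite -fixE -DX -rcosetE fixX.
    by case/rcosetP: Xh => m /(subsetP sMS) Sm ->; apply: groupM.
  exists (M :* h); rewrite ?rcoset_refl // inE; apply/andP; split.
    by apply/rcosetsP; exists h.
  by apply/afix1P/eqP; rewrite /= rcosetE fixE.
have unifF : {in F, forall X : {set gT}, #|X| = #|M|}.
  by move=> X /(subsetP sFR)/rcosetsP[x _ ->]; rewrite card_rcoset.
rewrite -coverF; apply: (@card_uniform_partition _ #|M| F (cover F)) => //.
apply/and3P; split=> //.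
apply/negP=> /unifF; rewrite cards0; have := cardG_gt0 M; lia.
Qed.

Lemma perm_char_divE M g :
  M \subset S -> g \in S ->
  ((perm_char S M g)%:R / (perm_char S M 1)%:R
     = #|[set h in S | g \in M :^ h]|%:R / #|S|%:R :> rat)%R.
Proof.
move=> sMS Sg; rewrite card_conj_contains //.
have cardS : #|S| = (perm_char S M 1 * #|M|)%N.
  rewrite -card_conj_contains ?group1 //; apply: eq_card => h.
  by rewrite inE group1 andbT.
rewrite cardS !natrM -mulf_div divff ?mulr1 //.
by rewrite pnatr_eq0 -lt0n cardG_gt0.
Qed.

Lemma gen2_subG (H : {group gT}) x y :
  (<<[set x; y]>> \subset H) = (x \in H) && (y \in H).
Proof. by rewrite gen_subG subUset !sub1set. Qed.

(** A union bound: by [perm_char_divE], each term of sigma is the probability that a random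
    conjugate of [M] contains [g]. *)
Lemma P_elt_le_sigma_elt g s :
  g \in S -> s \in S -> (P_elt S g s <= sigma_elt S g s)%R.
Proof.
move=> Sg Ss; rewrite /P_elt /sigma_elt.
under eq_bigr => M /setIdP[/maxgroupp/proper_sub sMS _].
  rewrite perm_char_divE //; over.
rewrite -mulr_suml -natr_sum ler_wpM2r ?invr_ge0 ?ler0n // ler_nat.
pose B M := [set h in S | g \in M :^ h].
apply: (@leq_trans #|\bigcup_(M in max_subgroups_containing S s) B M|).
  apply/subset_leq_card/subsetP=> h /setIdP[Sh neqS].
  have sHS : <<[set s ^ h; g]>> \subset S.
    by rewrite gen2_subG Sg groupJ.
  have [eqS | [M maxM sHM]] := maximal_exists sHS.
    by case/eqP: neqS; apply: eqS.
  move: sHM; rewrite gen2_subG => /andP[Msh Mg].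
  (* A maximal subgroup over [s ^ h] and [g], conjugated back by [h], contains [s]. *)
  apply/bigcupP; exists (M :^ h^-1)%G; rewrite inE.
    by rewrite /= -[gval S](conjGid (groupVr Sh)) maximalJ maxM mem_conjgV.
  by rewrite Sh /= -conjsgM mulVg conjsg1.
elim/big_rec2: _ => [|M m A _ IH]; first by rewrite cards0.
by apply: leq_trans (leq_card_setU _ _) _; rewrite leq_add2l.
Qed.

End Probabilistic.

(** * Subgroups of A7 containing a 7-cycle *)

Notation A7 := (Alt_group 'I_7).
Notation code p := (perm_seq 7 p).

Lemma mem_even7 (p : 'S_7) : p \in A7 -> code p \in even7.
Proof.
by rewrite Alt_even => ev_p; rewrite mem_filter mem_perm_seqs -odd_perm_seq ev_p.
Qed.

Lemma seq_perm_A7 l : is_perm_seq 7 l -> ~~ odd_seq l -> seq_perm 6 l \in A7.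
Proof. by move=> perm_l ev_l; rewrite Alt_even odd_perm_seq seq_permK. Qed.

Lemma card_A7 : #|A7| = 2520.
Proof.
have := @card_Alt 'I_7; rewrite card_ord => /(_ isT) eq2.
apply/eqP; rewrite -(eqn_pmul2l (ltn0Sn 1)) eq2; by vm_compute.
Qed.

Lemma card_A7_sub_leq (P : pred (seq nat)) :
  #|[set p in A7 | P (code p)]| <= count P even7.
Proof.
rewrite cardE -(size_map (fun p => code p)) -size_filter.
apply: uniq_leq_size => [|l /mapP[p]].
  by rewrite map_inj_uniq ?enum_uniq //; apply: perm_seq_inj.
by rewrite mem_enum => /setIdP[Ap Pp] ->; rewrite mem_filter Pp mem_even7.
Qed.

(** The injection of codes into [even7] bounds cardinalities from above; a lower bound comes from
    applying this to the complement. *)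
Lemma card_A7_sub_geq (P : pred (seq nat)) (A : {set 'S_7}) n :
  count (fun l => ~~ P l) even7 <= n ->
  (forall p, p \in A7 -> P (code p) -> p \in A) -> A \subset A7 -> 2520 - n <= #|A|.
Proof.
move=> le_n sPA sA.
have sub : A7 :\: A \subset [set p in A7 | ~~ P (code p)].
  apply/subsetP=> p /setDP[Ap]; rewrite inE Ap; exact/contra/sPA.
have := leq_trans (subset_leq_card sub) (card_A7_sub_leq (fun l => ~~ P l)).
rewrite cardsD (setIidPr sA) card_A7; move: #|A| (count _ _) le_n => a c; lia.
Qed.

Lemma third_lt b (x y : 'I_7) : third b x y < 7.
Proof.
have /allP/(_ (val x)) : all (fun x => all (fun y => third b x y < 7) (iota 0 7))
  (iota 0 7) by case: b; vm_compute.
rewrite mem_iota ltn_ord => /(_ isT)/allP/(_ (val y)).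
by rewrite mem_iota ltn_ord; apply.
Qed.

Lemma fano_autP b (p : 'S_7) :
  reflect (forall x y : 'I_7, third b (p x) (p y) = p (Ordinal (third_lt b x y)))
          (fano_aut b (code p)).
Proof.
apply: (iffP allP) => [aut_p x y | aut_p x].
  have:= aut_p x; rewrite mem_iota ltn_ord => /(_ isT)/allP/(_ (val y)).
  rewrite mem_iota ltn_ord => /(_ isT)/eqP.
  by rewrite !nth_perm_seq => ->; rewrite -nth_perm_seq.
rewrite mem_iota => lt_x; apply/allP=> y; rewrite mem_iota => lt_y.
have /= := aut_p (Ordinal lt_x) (Ordinal lt_y).
by rewrite -!nth_perm_seq /= => ->.
Qed.

Definition fano_set b := [set p in A7 | fano_aut b (code p)].

Lemma fano_group_set b : group_set (fano_set b).
Proof.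
apply/group_setP; split=> [|p q].
  by rewrite inE group1 perm_seq1; case: b; vm_compute.
case/setIdP=> Ap /fano_autP aut_p /setIdP[Aq /fano_autP aut_q].
apply/setIdP; split; first exact: groupM.
apply/fano_autP=> x y; rewrite !permM aut_q; congr (val (q _)).
by apply: val_inj; rewrite /= aut_p.
Qed.
Canonical fano_group b := Group (fano_group_set b).

Lemma fano_groupE b p : p \in A7 -> (p \in fano_group b) = fano_aut b (code p).
Proof. by move=> Ap; rewrite inE Ap. Qed.

Lemma fano_sub b : fano_group b \subset A7.
Proof. by apply/subsetP=> p /setIdP[]. Qed.

Lemma card_fano_leq b : #|fano_group b| <= 168.
Proof. exact: leq_trans (card_A7_sub_leq (fano_aut b)) (count_fano_aut b). Qed.

Lemma fano_proper b : fano_group b \proper A7.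
Proof.
rewrite properEcard fano_sub card_A7; exact: leq_ltn_trans (card_fano_leq b) _.
Qed.

(** * Generation of A7 by the shift and a second element *)

Definition rot7 : 'S_7 := seq_perm 6 shift7.

Lemma code_rot7 : code rot7 = shift7. Proof. exact: seq_permK. Qed.

Lemma rot7_A7 : rot7 \in A7. Proof. exact: seq_perm_A7. Qed.

Lemma rot7_fano b : rot7 \in fano_group b.
Proof. by rewrite fano_groupE ?rot7_A7 // code_rot7; case: b; vm_compute. Qed.

Lemma perm_eq1_code (p : 'S_7) : (p == 1) = (code p == iota 0 7).
Proof. by rewrite -perm_seq1 (inj_eq (@perm_seq_inj 7)). Qed.

Lemma order_dvd_code (p : 'S_7) k : (#[p] %| k) = (expseq (code p) k == iota 0 7).
Proof. by rewrite order_dvdn perm_eq1_code perm_seqX. Qed.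

Lemma order_rot7 : #[rot7] = 7.
Proof.
apply: nt_prime_order => //; last by rewrite perm_eq1_code code_rot7.
by apply/eqP; rewrite -order_dvdn order_dvd_code code_rot7.
Qed.

Lemma rot7X0 (k : 'I_7) : (rot7 ^+ k) ord0 = k.
Proof.
apply: val_inj; rewrite /= -nth_perm_seq perm_seqX code_rot7.
have /allP/(_ (val k)) : all (fun k => nth 0 (expseq shift7 k) 0 == k) (iota 0 7).
  by vm_compute.
by rewrite mem_iota ltn_ord => /(_ isT)/eqP.
Qed.

Lemma gen_wordsP g w : w \in gen_words (code g) ->
  exists2 x, x \in <<[set rot7; g]>> & code x = w.
Proof.
have /andP[Hs Hg] : (rot7 \in <<[set rot7; g]>>) && (g \in <<[set rot7; g]>>).
  by rewrite -gen2_subG.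
have rotP r : r \in [seq mulseq (expseq shift7 i) (code g) | i <- iota 0 7] ->
    exists2 x, x \in <<[set rot7; g]>> & code x = r.
  case/mapP=> i _ ->; exists (rot7 ^+ i * g); first by rewrite groupM ?groupX.
  by rewrite perm_seqM perm_seqX code_rot7.
rewrite /gen_words; move: [seq _ | i <- _] rotP => rot rotP.
have prodP (ws : seq (seq nat)) :
    (forall r, r \in ws -> exists2 x, x \in <<[set rot7; g]>> & code x = r) ->
  forall r, r \in [seq mulseq p q | p <- rot, q <- ws] ->
     exists2 x, x \in <<[set rot7; g]>> & code x = r.
  move=> wsP r /allpairsP[[p q] /= [/rotP[x Hx <-] /wsP[y Hy <-] ->]].
  by exists (x * y); rewrite ?groupM // perm_seqM.
rewrite !mem_cat => /or3P[/rotP // | |].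
  exact: (prodP rot rotP).
exact: (prodP _ (prodP rot rotP)).
Qed.

Lemma A7_gen_check g : g \in A7 -> gen_check (code g) -> <<[set rot7; g]>> = A7.
Proof.
move=> Ag /and3P[/hasP[w3 /gen_wordsP[x3 Hx3 <-]] /andP[]].
rewrite -!order_dvd_code => dv36 ndv32.
case/hasP=> [w4 /gen_wordsP[x4 Hx4 <-]] /andP[].
rewrite -!order_dvd_code => dv44 ndv42.
case/hasP=> [w5 /gen_wordsP[x5 Hx5 <-]] /andP[].
rewrite -!order_dvd_code => dv55 ndv51.
pose H := <<[set rot7; g]>>%G; have sHA : H \subset A7.
  by rewrite gen2_subG rot7_A7.
have [|not_sAH] := boolP (A7 \subset H).
  by move=> sAH; apply/eqP; rewrite eqEsubset sHA.
have prHA : H \proper A7 by rewrite properE sHA.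
have simA : simple A7 by apply: simple_Alt5; rewrite card_ord.
have := card_simple_leq_index _ _ _ simA prHA.
have := Lagrange sHA; rewrite card_A7.
(* An order dividing 6 but not 2 is 3 or 6. *)
have d3 : 3 %| #|H|.
  apply: dvdn_trans (order_dvdG Hx3);
  have := dvdn_leq (isT : 0 < 6) dv36; move: dv36 ndv32.
  by case: #[x3] => [|[|[|[|[|[|[|]]]]]]].
have d4 : 4 %| #|H|.
  apply: dvdn_trans (order_dvdG Hx4);
  have := dvdn_leq (isT : 0 < 4) dv44; move: dv44 ndv42.
  by case: #[x4] => [|[|[|[|[|]]]]].
have d5 : 5 %| #|H|.
  apply: dvdn_trans (order_dvdG Hx5);
  have := dvdn_leq (isT : 0 < 5) dv55; move: dv55 ndv51.
  by case: #[x5] => [|[|[|[|[|[|]]]]]].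
have d7 : 7 %| #|H|.
  by rewrite -[X in X %| _]order_rot7 order_dvdG // mem_gen // !inE eqxx.
have /dvdnP[k ->] : 3 * (4 * (5 * 7)) %| #|H|.
  by rewrite !Gauss_dvd // d3 d4 d5 d7.
(* The order of [H] is a nonzero multiple of 420 = 2520 / 6; but index at most 6 would give 2520 <=
   6! = 720. *)
move=> eqA le_f; have le6 : #|A7 : H| <= 6.
  case: k eqA => [//|k]; rewrite mulSn mulnDl => eqA.
  rewrite -(@leq_pmul2l (3 * (4 * (5 * 7)))) //.
  by rewrite -[X in _ <= X]/2520 -eqA leq_addr.
by have := leq_trans le_f (leq_fact le6).
Qed.

Lemma code_conjV (g h : 'S_7) : code (g ^ h^-1) = conjseq (code g) (code h).
Proof. by rewrite conjgE invgK !perm_seqM perm_seqV. Qed.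

Lemma rot7_gen_A7 g :
  g \in A7 -> (forall b, g \notin fano_group b) -> <<[set rot7; g]>> = A7.
Proof.
(* [rot7 ^+ k] takes 0 to [k], which [g] takes back to 0, so [g'] fixes 0 as [gen_checkP]
   demands. *)
move=> Ag fano'g; pose k : 'I_7 := g^-1 ord0; pose g' := rot7 ^+ k * g.
have sg'A b : (g' \in fano_group b) = (g \in fano_group b).
  by rewrite groupMl // groupX // rot7_fano.
have Ag' : g' \in A7 by rewrite groupM // groupX // rot7_A7.
have g'0 : g' ord0 = ord0 by rewrite permM rot7X0 permKV.
have <- : <<[set rot7; g']>> = <<[set rot7; g]>>.
  apply/eqP; rewrite eqEsubset !gen2_subG /=.
  have Hs x : rot7 \in <<[set rot7; x]>> by rewrite mem_gen // !inE eqxx.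
  have Hx x : x \in <<[set rot7; x]>> by rewrite mem_gen // !inE eqxx orbT.
  rewrite !Hs /= groupM ?groupX ?Hs ?Hx //=.
  by rewrite -(mulKg (rot7 ^+ k) g) groupM ?groupV ?groupX ?Hs ?Hx.
apply: A7_gen_check => //; apply: (allP gen_checkP).
rewrite mem_filter -!fano_groupE // !sg'A !fano'g mem_filter mem_even7 //.
by rewrite andbT (nth_perm_seq 7 g' ord0) g'0.
Qed.

Lemma rot7_gen_fano g :
  g \in A7 -> (<<[set rot7; g]>> != A7) = [exists b, g \in fano_group b].
Proof.
move=> Ag; apply/idP/idP => [|/existsP[b Mg]].
  apply: contraR; rewrite negb_exists => /forallP fano'g.
  exact/eqP/rot7_gen_A7.
apply: contraTneq (fano_proper b) => <-.
by rewrite properE negb_and negbK gen2_subG rot7_fano Mg orbT.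
Qed.

Definition fano_elt_seq b : seq nat :=
  (if b then [:: 0; 1; 3; 2; 6; 5; 4] else [:: 0; 1; 4; 3; 2; 6; 5])%N.
Definition fano_elt b : 'S_7 := seq_perm 6 (fano_elt_seq b).

Lemma code_fano_elt b : code (fano_elt b) = fano_elt_seq b.
Proof. by apply: seq_permK; case: b. Qed.

Lemma fano_elt_A7 b : fano_elt b \in A7.
Proof. by apply: seq_perm_A7; case: b. Qed.

Lemma mem_fano_elt b c : (fano_elt b \in fano_group c) = (b == c).
Proof.
rewrite fano_groupE ?fano_elt_A7 // code_fano_elt.
by case: b; case: c; vm_compute.
Qed.

(** An overgroup with an element [g] outside M_b has one outside both stabilisers: [g] itself or
    [g * fano_elt b]. With the shift it generates A7. *)
Lemma fano_maximal b : maximal (fano_group b) A7.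
Proof.
apply/maxgroupP; split=> [|H prHA sMH]; first exact: fano_proper.
apply/eqP; rewrite eqEsubset sMH andbT; apply/subsetP=> g Hg.
have sHA := proper_sub prHA; have Ag := subsetP sHA g Hg.
apply: contraTT prHA => Mb'g.
have [g1 Hg1 fano'g1] : exists2 g1, g1 \in H & forall c, g1 \notin fano_group c.
  have negE c : c != b -> c = ~~ b by case: c b {Mb'g sMH} => [] [].
  have [Mg|M'g] := boolP (g \in fano_group (~~ b)).
    exists (g * fano_elt b) => [|c].
      by rewrite groupM // (subsetP sMH) // mem_fano_elt.
    have [->|/negE->] := eqVneq c b; first by rewrite groupMr ?mem_fano_elt.
    by rewrite groupMl // mem_fano_elt; case: (b).
  by exists g => // c; have [->|/negE->] := eqVneq c b.
have Ag1 := subsetP sHA _ Hg1.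
rewrite properE sHA /= negbK -(rot7_gen_A7 g1) // gen2_subG Hg1 andbT.
exact: subsetP sMH _ (rot7_fano b).
Qed.

(** A group contained in neither stabiliser is not covered by their union: if [g1] and [g2] each
    avoid just one of them, [g1 * g2] avoids both. *)
Lemma max_subgroups_rot7 :
  max_subgroups_containing A7 rot7 = [set fano_group true; fano_group false].
Proof.
apply/setP=> M; rewrite inE !inE; apply/andP/orP; last first.
  by case=> /eqP->; rewrite fano_maximal rot7_fano.
case=> maxM Ms.
have prM := maxgroupp maxM; have sMA := proper_sub prM.
have subM b : M \subset fano_group b -> M = fano_group b.
  move=> sMF; apply: val_inj => /=.
  by have /maxgroupP[_ ->] := maxM; rewrite ?fano_proper.
have [/subM->|/subsetPn[g1 Mg1 F1'g1]] := boolP (M \subset fano_group true).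
  by left.
have [/subM->|/subsetPn[g2 Mg2 F2'g2]] := boolP (M \subset fano_group false).
  by right.
suffices [g Mg fano'g] : exists2 g, g \in M & forall c, g \notin fano_group c.
  case/negP: (proper_subn prM); rewrite -(rot7_gen_A7 g) ?(subsetP sMA) //.
  by rewrite gen2_subG Ms.
have [F2g1|F2'g1] := boolP (g1 \in fano_group false); last by exists g1 => // -[].
have [F1g2|F1'g2] := boolP (g2 \in fano_group true); last by exists g2 => // -[].
exists (g1 * g2) => [|[]]; first exact: groupM.
  by rewrite groupMr.
by rewrite groupMl.
Qed.

(** * Fixed points on the cosets of the two stabilisers *)

Definition fano_reps b : seq 'S_7 := map (seq_perm 6) (fano_trans b).

Lemma fano_reps_code b t : t \in fano_reps b -> code t \in fano_trans b /\ t \in A7.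
Proof.
have /allP tr : all (fun l => is_perm_seq 7 l && ~~ odd_seq l) (fano_trans b).
  by case: b; vm_compute.
case/mapP=> l l_tr ->; have /andP[perm_l ev_l] := tr l l_tr.
by rewrite seq_permK // seq_perm_A7.
Qed.

Lemma code_fano_reps b : map (fun t : 'S_7 => code t) (fano_reps b) = fano_trans b.
Proof.
have /allP tr : all (is_perm_seq 7) (fano_trans b) by case: b; vm_compute.
rewrite /fano_reps -map_comp -[RHS]map_id; apply/eq_in_map=> l /tr.
exact: seq_permK.
Qed.

#[local] Opaque even7 fano_trans fano_reps fano_set fano_aut rot7 Alt vec7 mat7.

Lemma fano_reps_cover b h : h \in A7 ->
  exists2 t, t \in fano_reps b & h * t^-1 \in fano_group b.
Proof.
move=> Ah; have /hasP[l] := allP (fano_trans_cover b) _ (mem_even7 _ Ah).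
rewrite -code_fano_reps => /mapP[t Rt ->] aut_ht; exists t => //.
have [_ At] := fano_reps_code _ _ Rt.
by rewrite fano_groupE ?groupM ?groupV // perm_seqM perm_seqV.
Qed.

Lemma count_fano_reps b g : g \in A7^# ->
  count (fun t : 'S_7 => g ^ t^-1 \in fano_group b) (fano_reps b) <= 3.
Proof.
case/setD1P=> ntg Ag; have /orP[] := allP (count_fano_fix b) _ (mem_even7 _ Ag).
  by rewrite -perm_eq1_code (negPf ntg).
rewrite -code_fano_reps count_map; apply: leq_trans.
rewrite (@eq_in_count _ _ (preim (fun t : 'S_7 => code t)
           (fun l => fano_aut b (conjseq (code g) l)))) // => t Rt /=.
have [_ At] := fano_reps_code _ _ Rt.
by rewrite fano_groupE ?groupJ ?groupV // code_conjV.
Qed.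

Lemma perm_char_fano_leq b g : g \in A7 ->
  perm_char A7 (fano_group b) g
    <= count (fun t : 'S_7 => g ^ t^-1 \in fano_group b) (fano_reps b).
Proof.
move=> Ag; rewrite -size_filter -(size_map (fun t => fano_group b :* t)).
apply: leq_trans (card_size _); apply/subset_leq_card/subsetP=> X.
case/setIP=> /rcosetsP[x Ax ->] /afix1P/= fixX.
have [t Rt Mxt] := fano_reps_cover b _ Ax.
have Dx : fano_group b :* x = fano_group b :* t.
  by apply/rcoset_eqP; rewrite mem_rcoset.
rewrite Dx; apply: (map_f (fun t : 'S_7 => fano_group b :* t)).
rewrite mem_filter Rt andbT.
have : t * g \in fano_group b :* t.
  by rewrite -Dx -fixX Dx !rcosetE -rcosetM rcoset_refl.
by rewrite mem_rcoset conjgE invgK mulgA.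
Qed.

(** There are at most 15 cosets of at most 168 elements each, and 15 * 168 = 2520 forces
    equality. *)
Lemma perm_char_fano1 b : perm_char A7 (fano_group b) 1 = 15.
Proof.
have sMA := fano_sub b.
have := @card_conj_contains _ A7 _ 1 sMA (group1 _).
have -> : [set h in A7 | 1 \in fano_group b :^ h] = A7.
  by apply/setP=> h; rewrite inE group1 andbT.
rewrite card_A7.
have le_n : perm_char A7 (fano_group b) 1 <= 15.
  apply: leq_trans (perm_char_fano_leq b _ (group1 _)) _.
  by apply: leq_trans (count_size _ _) _; rewrite size_map; case: (b).
move: le_n (card_fano_leq b); move: (perm_char _ _ _) #|_| => n m le_n le_m eqA.
apply/eqP; rewrite eqn_leq le_n /= -(@leq_pmul2r 168) //.
rewrite -[X in X <= _]/2520 eqA.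
by rewrite leq_mul2l le_m orbT.
Qed.

Lemma perm_char_fanoJ b x g : x \in A7 -> g \in A7 ->
  perm_char A7 (fano_group b :^ x) g = perm_char A7 (fano_group b) g.
Proof.
move=> Ax Ag; have sMA := fano_sub b.
have sMxA : fano_group b :^ x \subset A7 by rewrite -(conjGid Ax) conjSg.
apply/eqP; rewrite -(@eqn_pmul2r #|fano_group b|) ?cardG_gt0 //.
rewrite -{1}(cardJg _ x) -!card_conj_contains //; apply/eqP.
rewrite -(card_imset _ (mulgI x)); apply: eq_card => h; rewrite [RHS]inE.
apply/imsetP/andP=> [[k /setIdP[Ak gk] ->] | [Ah gh]].
  by rewrite groupM // conjsgM.
by exists (x^-1 * h); rewrite ?mulKVg // inE groupM ?groupV // -conjsgM mulKVg.
Qed.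

(** Every element of order 7 is, up to a generator of the same cyclic group, a
    conjugate in A7 of the shift: A7 has two classes of elements of order 7,
    interchanged by inversion. *)
Definition order7_in (x s : 'S_7) := x \in A7 /\ <[s]> = <[rot7 ^ x]>.

Definition reflect7 : 'S_7 := seq_perm 6 [:: 0; 6; 5; 4; 3; 2; 1]%N.

Lemma rot7_reflect : rot7 ^ reflect7 = rot7^-1.
Proof.
apply: (@perm_seq_inj 7); rewrite conjgE !perm_seqM !perm_seqV.
by rewrite code_rot7 seq_permK //; vm_compute.
Qed.

(** The map [y] taking i to the image of 0 under [s ^+ i] conjugates the shift to [s]. If [y] is
    odd, it is preceded by the odd reflection x -> -x; this yields the inverse of [s], which
    generates the same subgroup. *)
Lemma cycle7_conj_rot7 s :
    uniq (traject (nth 0%N (code s)) 0%N 7) -> expseq (code s) 7 == iota 0 7 ->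
  exists x, order7_in x s.
Proof.
move=> uniq_s s7; have {}s7 : s ^+ 7 = 1.
  by apply/eqP; rewrite -order_dvdn order_dvd_code.
have iterE k : iter k (nth 0%N (code s)) 0%N = (s ^+ k) ord0.
  elim: k => [|k IHk]; first by rewrite expg0 perm1.
  by rewrite iterS IHk nth_perm_seq expgSr permM.
pose f (i : 'I_7) := (s ^+ i) ord0.
have f_inj : injective f.
  move=> i j eq_f; apply/ord_inj/eqP.
  rewrite -(nth_uniq 0%N _ _ uniq_s) ?size_traject ?ltn_ord //.
  by rewrite !nth_traject ?ltn_ord // !iterE -/(f i) eq_f.
pose y := perm f_inj; have yE i : y i = (s ^+ i) ord0 by rewrite permE.
have s0y : rot7 ^ y = s.
  apply/permP=> j; rewrite -[j](permKV y) permJ; move: (y^-1 j) => {j}i.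
  rewrite !yE -[RHS]permM -expgSr.
  have -> : rot7 i = i.+1 %% 7 :> nat.
    rewrite -nth_perm_seq code_rot7.
    by case: i => [[|[|[|[|[|[|[|]]]]]]]].
  congr (fun_of_perm _ _).
  by rewrite {2}(divn_eq i.+1 7) expgD mulnC expgM s7 expg1n mul1g.
have [Ay|A'y] := boolP (y \in A7); first by exists y; split; rewrite ?s0y.
exists (reflect7 * y); split; last by rewrite conjgM rot7_reflect conjVg cycleV s0y.
rewrite Alt_even odd_permM (odd_perm_seq 7 reflect7) seq_permK //.
by move: A'y; rewrite Alt_even => /negbNE->.
Qed.

Lemma cycle_mem (s t : 'S_7) (H : {group 'S_7}) :
  <[s]> = <[t]> -> (s \in H) = (t \in H).
Proof. by move=> eq_st; rewrite -!cycle_subG eq_st. Qed.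

Lemma gen2_cycle (s t g : 'S_7) : <[s]> = <[t]> -> <<[set s; g]>> = <<[set t; g]>>.
Proof.
move=> eq_st; apply/eqP; rewrite eqEsubset !gen2_subG.
have memL x y : x \in <<[set x; y]>> by rewrite mem_gen // !inE eqxx.
have memR x y : y \in <<[set x; y]>> by rewrite mem_gen // !inE eqxx orbT.
rewrite (cycle_mem s t <<[set t; g]>>%G) // memL memR.
by rewrite -(cycle_mem s t <<[set s; g]>>%G) // memL memR.
Qed.

Lemma gen2J (s g h : 'S_7) : <<[set s ^ h; g ^ h]>> = <<[set s; g]>> :^ h.
Proof. by rewrite -genJ conjUg !conjg_set1. Qed.

(** Conjugating back by [x * h] replaces the first generator by the shift, up to a generator of the
    same cyclic group. *)
Lemma order7_gen_fano x s h g : order7_in x s -> h \in A7 -> g \in A7 ->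
  (<<[set s ^ h; g]>> != A7) = [exists b, g ^ (x * h)^-1 \in fano_group b].
Proof.
case=> Ax cyc_s Ah Ag; rewrite -rot7_gen_fano ?groupJ ?groupV ?groupM //.
have -> : <<[set s ^ h; g]>> = <<[set rot7; g ^ (x * h)^-1]>> :^ (x * h).
  rewrite -gen2J conjgKV; apply: gen2_cycle.
  by rewrite !cycleJ cyc_s cycleJ conjsgM.
by rewrite -{1}(conjGid (groupM Ax Ah)) (inj_eq (@conjsg_inj _ _)).
Qed.

Lemma order7_order x s : order7_in x s -> #[s] = 7.
Proof.
by case=> _ cyc_s; rewrite /order cyc_s -/(order (rot7 ^ x)) orderJ order_rot7.
Qed.

Lemma order7_mem x s : order7_in x s -> s \in A7^#.
Proof.
move=> o7; have [Ax cyc_s] := o7; apply/setD1P; split.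
  by rewrite -order_eq1 (order7_order _ _ o7).
by rewrite (cycle_mem _ _ A7 cyc_s) groupJ ?rot7_A7.
Qed.

Definition has_blocks s := exists2 bs, bs \in block_systems & all (swaps (code s)) bs.

Lemma order7_or_blocks s : s \in A7 ->
  (exists x, order7_in x s) \/ #[s] <> 7 /\ has_blocks s.
Proof.
move=> As; have /orP[/andP[uniq_s s7]|] := allP cycle_or_blocks _ (mem_even7 _ As).
  by left; apply: cycle7_conj_rot7.
case/andP=> not7 /hasP[bs bl sw]; right; split; last by exists bs.
move=> o7; case/orP: not7; first by rewrite -order_dvd_code o7.
by rewrite -perm_eq1_code -order_eq1 o7.
Qed.

Lemma order7P s : s \in A7 -> #[s] = 7 -> exists x, order7_in x s.
Proof. by move=> As o7; case: (order7_or_blocks s As) => // -[]. Qed.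

(** * The values of sigma and P *)

Lemma max_subgroups_order7 (x s : 'S_7) : order7_in x s ->
  max_subgroups_containing A7 s =
    [set (fano_group true :^ x)%G; (fano_group false :^ x)%G].
Proof.
case=> Ax cyc_s; apply/setP=> M.
have -> : (M \in max_subgroups_containing A7 s)
        = ((M :^ x^-1)%G \in max_subgroups_containing A7 rot7).
  rewrite !inE (cycle_mem _ _ M cyc_s) mem_conjgV; congr (_ && _).
  by rewrite /= -[in RHS](conjGid (groupVr Ax)) maximalJ.
rewrite max_subgroups_rot7 !inE.
by congr (_ || _); apply/eqP/eqP=> [<-|->]; apply: val_inj;
  rewrite /= ?conjsgKV ?conjsgK.
Qed.

Lemma fano_neq x : (fano_group true :^ x)%G != (fano_group false :^ x)%G.
Proof.
apply/eqP=> /(congr1 val)/= /conjsg_inj eqF.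
have := mem_fano_elt true true; rewrite eqxx.
have -> : (fano_elt true \in fano_group true) = (fano_elt true \in fano_group false).
  by rewrite [_ \in fano_group true]/(_ \in fano_set true) eqF.
by rewrite mem_fano_elt.
Qed.

Lemma rat_frac_leq (m n : nat) (a b : nat) : (0 < n)%N -> (0 < b)%N ->
  (m%:R / n%:R <= a%:R / b%:R :> rat)%R = (m * b <= a * n)%N.
Proof.
move=> n_gt0 b_gt0.
by rewrite ler_pdivlMr ?ltr0n // mulrAC ler_pdivrMr ?ltr0n // -!natrM ler_nat.
Qed.

Lemma sigma_elt_order7_leq (x s g : 'S_7) : order7_in x s -> g \in A7^# ->
  (sigma_elt A7 g s <= 2 / 5)%R.
Proof.
move=> o7 ntAg; have [_ Ag] := setD1P ntAg; have [Ax _] := o7.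
rewrite /sigma_elt (max_subgroups_order7 _ _ o7) big_setU1 ?inE ?fano_neq //=.
rewrite big_set1 !perm_char_fanoJ // !perm_char_fano1 -mulrDl -natrD rat_frac_leq //.
have le3 b := leq_trans (perm_char_fano_leq b _ Ag) (count_fano_reps b _ ntAg).
(* The numerator is at most 3 + 3 = 6, and 6 / 15 = 2 / 5. *)
rewrite (leq_trans (n := 6 * 5)) // leq_mul2r /=.
exact: (leq_add (le3 true) (le3 false)).
Qed.

Definition involution7 : 'S_7 := seq_perm 6 [:: 0; 1; 2; 4; 3; 6; 5]%N.

Lemma involution7_A7 : involution7 \in A7^#.
Proof.
apply/setD1P; rewrite perm_eq1_code seq_permK //; split=> //.
exact: seq_perm_A7.
Qed.

Lemma P_elt_order7_geq (x s : 'S_7) : order7_in x s ->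
  (2 / 5 <= P_elt A7 involution7 s)%R.
Proof.
move=> o7; have [Ax _] := o7; have /setD1P[_ Ag] := involution7_A7.
rewrite /P_elt card_A7 rat_frac_leq //.
apply: (@leq_trans (1008 * 5)) => //; rewrite leq_pmul2r //.
pose A := [set k in A7 | [exists b, involution7 ^ k^-1 \in fano_group b]].
have <- : #|A| = #|[set h in A7 | <<[set s ^ h; involution7]>> != A7]|.
  rewrite -[RHS](card_imset _ (mulgI x)); apply: eq_card => k.
  apply/setIdP/imsetP=> [[Ak gk] | [h /setIdP[Ah gh] ->]].
    exists (x^-1 * k); rewrite ?mulKVg // inE groupM ?groupV //=.
    by rewrite (order7_gen_fano _ _ _ _ o7) ?mulKVg // groupM ?groupV.
  by rewrite groupM // -(order7_gen_fano _ _ _ _ o7).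
apply: leq_trans (card_A7_sub_geq _ A _ count_involution _ _) => //.
  move=> p Ap; rewrite inE Ap => aut_p; apply/existsP.
  have codeE b : (involution7 ^ p^-1 \in fano_group b)
     = fano_aut b (conjseq [:: 0; 1; 2; 4; 3; 6; 5]%N (code p)).
    by rewrite fano_groupE ?groupJ ?groupV // code_conjV seq_permK.
  by case/orP: aut_p => aut_p; [exists true | exists false]; rewrite codeE.
by apply/subsetP=> p /setIdP[].
Qed.

(** Both generators preserve {a, b}, whereas A7 is transitive. The case [a = b] of a common fixed
    point is included. *)
Lemma blocks_not_gen (s g : 'S_7) (a b : 'I_7) :
  s a = b -> s b = a -> g a = a -> g b = b -> <<[set s; g]>> != A7.
Proof.
move=> sa sb ga gb; apply/eqP=> genA.
have sAN : A7 \subset 'N([set a; b] | 'P).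
  rewrite -genA gen2_subG; apply/andP; split; apply/astabsP=> y;
    rewrite !inE /= apermE.
    by rewrite -(inj_eq (@perm_inj _ s) y a) -(inj_eq (@perm_inj _ s) y b) sa sb orbC.
  by rewrite -(inj_eq (@perm_inj _ g) y a) -(inj_eq (@perm_inj _ g) y b) ga gb.
have [z] : exists z : 'I_7, z \notin [set a; b].
  apply/existsP; apply: contraT; rewrite negb_exists => /forallP allab.
  have: [set: 'I_7] \subset [set a; b].
    by apply/subsetP=> z _; have := allab z; rewrite negbK.
  by move/subset_leq_card; rewrite cardsT card_ord cards2; case: (a != b).
(* A power of the shift that takes [a] to the outside point [z]. *)
pose c : 'S_7 := (rot7 ^+ a)^-1 * rot7 ^+ z.
have Ac : c \in A7 by rewrite groupM ?groupV ?groupX ?rot7_A7.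
have a0 : (rot7 ^+ a)^-1 a = ord0.
  by apply: (@perm_inj _ (rot7 ^+ a)); rewrite permKV rot7X0.
have ca : c a = z by rewrite permM a0 rot7X0.
have /astabsP/(_ a) := subsetP sAN c Ac.
by rewrite /= apermE ca [RHS]inE !inE eqxx /= => ->.
Qed.

Definition cycle3 : 'S_7 := seq_perm 6 [:: 1; 2; 0; 3; 4; 5; 6]%N.

Lemma cycle3_A7 : cycle3 \in A7^#.
Proof.
apply/setD1P; rewrite perm_eq1_code seq_permK //; split=> //.
exact: seq_perm_A7.
Qed.

Lemma cycle3_fix (i : 'I_7) : ~~ (i < 3) -> cycle3 i = i.
Proof.
move=> i_ge3; apply: ord_inj; rewrite -nth_perm_seq seq_permK //.
by case: i i_ge3 => [[|[|[|[|[|[|[|]]]]]]]].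
Qed.

Lemma block_lt bs e : bs \in block_systems -> e \in bs -> e.1 < 7 /\ e.2 < 7.
Proof.
by move=> /(allP block_systems_lt)/allP bs_lt /bs_lt/andP.
Qed.

Lemma P_elt_blocks_gt s : has_blocks s -> (2 / 5 < P_elt A7 cycle3 s)%R.
Proof.
case=> bs bl sw.
pose A := [set h in A7 | <<[set s ^ h; cycle3]>> != A7].
have sAA : A \subset A7 by apply/subsetP=> h /setIdP[].
rewrite /P_elt -/A ltNge card_A7 rat_frac_leq // -ltnNge.
apply: (@leq_ltn_trans (1008 * 5)) => //; rewrite ltn_pmul2r //.
have cnt := allP count_blocks _ bl.
pose Q (h : seq nat) :=
  has (fun e => ~~ ((nth 0%N h e.1 < 3) || (nth 0%N h e.2 < 3))) bs.
(* Strictness matters: at most 1511 exceptions leave at least 1009 > 1008 = (2/5) 2520 elements. *)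
have le_c : count (fun h => ~~ Q h) even7 <= 1511.
  rewrite -ltnS; apply: leq_ltn_trans cnt; apply: sub_count => h.
  by rewrite /= /Q -all_predC; apply: sub_all => e /=; rewrite negbK.
suff sQA h : h \in A7 -> Q (code h) -> h \in A.
  exact: (card_A7_sub_geq Q A 1511 le_c sQA sAA).
move=> Ah /hasP[e bs_e].
have [lt1 lt2] := block_lt _ _ bl bs_e.
rewrite -[e.1]/(val (Ordinal lt1)) -[e.2]/(val (Ordinal lt2)) !nth_perm_seq.
rewrite negb_or => /andP[h1 h2]; rewrite inE Ah.
have /andP[/eqP s1 /eqP s2] := allP sw e bs_e.
apply: (@blocks_not_gen _ _ (h (Ordinal lt1)) (h (Ordinal lt2)));
  rewrite ?cycle3_fix // permJ; congr (fun_of_perm _ _); apply: ord_inj.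
  by rewrite -nth_perm_seq /= s1.
by rewrite -nth_perm_seq /= s2.
Qed.

(** At the involution 2/5 <= P <= sigma, while P <= sigma <= 2/5 everywhere, so both maxima equal
    2/5. *)
Lemma order7_sigma_P (s : 'S_7) : s \in A7 -> #[s] = 7 ->
  sigma_at A7 s = (2 / 5)%R /\ P_at A7 s = (2 / 5)%R.
Proof.
move=> As /(order7P _ As)[x o7].
have nzA : A7^# != set0 by apply/set0Pn; exists involution7; apply: involution7_A7.
have [ntI AI] := setD1P involution7_A7.
have leP g : g \in A7^# -> (P_elt A7 g s <= 2 / 5)%R.
  move=> ntAg; have [_ Ag] := setD1P ntAg.
  exact: le_trans (P_elt_le_sigma_elt _ _ _ _ Ag As)
                 (sigma_elt_order7_leq _ _ _ o7 ntAg).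
have geP := P_elt_order7_geq _ _ o7.
split; apply/le_anti/andP; split.
- by apply: max_on_le nzA _ => g; apply: sigma_elt_order7_leq o7.
- apply: le_trans (max_on_ge _ _ _ _ involution7_A7).
  exact: le_trans geP (P_elt_le_sigma_elt _ _ _ _ AI As).
- exact: max_on_le nzA leP.
by apply: le_trans (max_on_ge _ _ _ _ involution7_A7).
Qed.

Lemma blocks_sigma_P (s : 'S_7) : s \in A7 -> has_blocks s ->
  (2 / 5 < sigma_at A7 s)%R /\ (2 / 5 < P_at A7 s)%R.
Proof.
move=> As bl; have gtP := P_elt_blocks_gt _ bl; have [_ Ac] := setD1P cycle3_A7.
split; last exact: lt_le_trans gtP (max_on_ge _ _ _ _ cycle3_A7).
apply: lt_le_trans (max_on_ge _ _ _ _ cycle3_A7).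
exact: lt_le_trans gtP (P_elt_le_sigma_elt _ _ _ _ Ac As).
Qed.

Lemma sigma_P_order7 (s : 'S_7) : s \in A7^# ->
  (sigma_at A7 s = (2 / 5)%R <-> #[s] = 7) /\ (P_at A7 s = (2 / 5)%R <-> #[s] = 7).
Proof.
case/setD1P=> _ As; have [[x o7]|[not7 bl]] := order7_or_blocks s As.
  have os := order7_order _ _ o7; have [-> ->] := order7_sigma_P _ As os.
  by split; split.
have [gt1 gt2] := blocks_sigma_P _ As bl.
by split; split=> // eq; move: gt1 gt2; rewrite eq ltxx.
Qed.

Lemma sigma_P_min : sigma_min A7 = (2 / 5)%R /\ P_min A7 = (2 / 5)%R.
Proof.
have ntA : rot7 \in A7^#.
  by apply: (@order7_mem 1); split; rewrite ?group1 // conjg1.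
have [eq1 eq2] := order7_sigma_P _ rot7_A7 order_rot7.
have ge s : s \in A7^# -> (2 / 5 <= sigma_at A7 s)%R /\ (2 / 5 <= P_at A7 s)%R.
  case/setD1P=> _ As; have [[x o7]|[_ bl]] := order7_or_blocks s As.
    have [-> ->] := order7_sigma_P _ As (order7_order _ _ o7).
    by split; apply: lexx.
  by have [gt1 gt2] := blocks_sigma_P _ As bl; split; apply: ltW.
split; [rewrite -eq1 | rewrite -eq2]; apply: min_on_eq => // s /ge[].
  by rewrite eq1.
by rewrite eq2.
Qed.

Lemma fano_not_conj x y : x \in A7 -> y \in A7 ->
  fano_group true :^ x <> fano_group false :^ y.
Proof.
move=> Ax Ay eqF; pose z := x * y^-1; have Az : z \in A7 by rewrite groupM ?groupV.
have memE g : g \in A7 -> g \in fano_group false ->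
    fano_aut true (conjseq (code g) (code z)).
  move=> Ag Fg; have Agz : g ^ z^-1 \in A7 by rewrite groupJ ?groupV.
  rewrite -code_conjV -(fano_groupE _ _ Agz) -mem_conjg conjsgM.
  by rewrite eqF -conjsgM mulgV conjsg1.
have /negP[] := allP not_conj_check _ (mem_even7 _ Az).
rewrite -code_rot7 memE ?rot7_A7 ?rot7_fano //=.
rewrite -[X in conjseq X _](code_fano_elt false).
by rewrite memE ?fano_elt_A7 ?mem_fano_elt.
Qed.

(** * Spread *)

Lemma count_exists_leq (T : Type) (I : finType) (P : I -> pred T) r :
  count (fun t => [exists i, P i t]) r <= \sum_i count (P i) r.
Proof.
elim: r => [|t r IHr] /=; first by rewrite sum_nat_const muln0.
rewrite big_split /= leq_add //; case: existsP => [[i Pit]|//].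
by rewrite (bigD1 i) //= Pit.
Qed.

Lemma fano_conjVM b m t g : m \in fano_group b ->
  (g ^ (m * t)^-1 \in fano_group b) = (g ^ t^-1 \in fano_group b).
Proof. by move=> Fm; rewrite invMg conjgM groupJr ?groupV. Qed.

Definition bad_rep n (g : 'I_n -> 'S_7) b (t : 'S_7) :=
  [exists i, g i ^ t^-1 \in fano_group b].

Lemma size_fano_reps b : size (fano_reps b) = 15.
Proof. by rewrite -(size_map (fun t : 'S_7 => code t)) code_fano_reps; case: b. Qed.

Lemma uniq_fano_reps b : uniq (fano_reps b).
Proof.
apply: (@map_uniq _ _ (fun t : 'S_7 => code t)); rewrite code_fano_reps.
by case: b; vm_compute.
Qed.

(** Each of the three elements fixes at most 3 of the 15 cosets, and 15 - 9 = 6. *)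
Lemma good_rep_count (g : 'I_3 -> 'S_7) b : (forall i, g i \in A7^#) ->
  6 <= count (predC (bad_rep 3 g b)) (fano_reps b).
Proof.
move=> ntg; have := count_predC (bad_rep 3 g b) (fano_reps b).
rewrite size_fano_reps.
suff : count (bad_rep 3 g b) (fano_reps b) <= 9 by move: (count _ _) (count _ _); lia.
apply: leq_trans (count_exists_leq _ _ _ _) _.
by apply: (@leq_trans (\sum_(i < 3) 3));
  rewrite ?leq_sum ?sum_nat_const ?card_ord // => i _;
  apply: count_fano_reps.
Qed.

Lemma aut_reps_fano :
  all (fun l => is_perm_seq 7 l && ~~ odd_seq l && fano_aut true l) aut_reps.
Proof. by vm_compute. Qed.

Definition even_nontrivial l := [&& is_perm_seq 7 l, ~~ odd_seq l & l != iota 0 7].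

Lemma antiflagP t u : t \in A7 -> u \in A7 -> antiflag (code t) (code u) ->
  exists2 m, m \in fano_group true & m * t * u^-1 \in fano_group false.
Proof.
move=> At Au /hasP[l lm aut_l].
have /andP[/andP[perm_l ev_l] aut_tl] :
    is_perm_seq 7 l && ~~ odd_seq l && fano_aut true l.
  exact: allP aut_reps_fano _ lm.
exists (seq_perm 6 l); rewrite fano_groupE ?groupM ?groupV ?seq_perm_A7 //.
  by rewrite seq_permK.
by rewrite !perm_seqM perm_seqV seq_permK.
Qed.

Lemma good_conj (g : 'I_3 -> 'S_7) : (forall i, g i \in A7^#) ->
  exists2 k, k \in A7 & forall i b, g i ^ k^-1 \notin fano_group b.
Proof.
move=> ntg.
have [t1 [t2 [Xt1 Xt2 neq_t]]] : exists t1 t2,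
    [/\ t1 \in filter (predC (bad_rep 3 g true)) (fano_reps true),
        t2 \in filter (predC (bad_rep 3 g true)) (fano_reps true) & t1 != t2].
  have := good_rep_count g true ntg; rewrite -size_filter.
  have := filter_uniq (predC (bad_rep 3 g true)) (uniq_fano_reps true).
  case: (filter _ _) => [//|t1 [//|t2 r]] /= /andP[t1r _] _.
  exists t1, t2; rewrite !inE !eqxx orbT; split=> //.
  by apply: contraNneq t1r => ->; rewrite mem_head.
move: Xt1 Xt2; rewrite !mem_filter => /andP[good1 Rt1] /andP[good2 Rt2].
have [ct1 At1] := fano_reps_code _ _ Rt1; have [ct2 At2] := fano_reps_code _ _ Rt2.
have := allP (allP antiflag_check _ ct1) _ ct2.
rewrite (inj_eq (@perm_seq_inj 7)) (negPf neq_t) /= => le5.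
(* At least 6 planes are unfixed and at most 5 are incident with both points, so some unfixed plane
   forms an antiflag with [t1] or [t2]. *)
have [u Ru /andP[good_u anti_u]] : exists2 u, u \in fano_reps false &
    ~~ bad_rep 3 g false u && (antiflag (code t1) (code u) || antiflag (code t2) (code u)).
  apply/hasP; apply: contraLR le5 => /hasPn no_u; rewrite -ltnNge.
  apply: leq_trans (good_rep_count g false ntg) _.
  rewrite -code_fano_reps count_map -!size_filter.
  apply: uniq_leq_size => [|v]; first exact/filter_uniq/uniq_fano_reps.
  rewrite !mem_filter => /andP[good_v Rv]; rewrite Rv andbT /=.
  by have := no_u v Rv; rewrite [~~ bad_rep _ _ _ _]good_v.
have [_ Au] := fano_reps_code _ _ Ru.
have [t At [good_t [m Fm Fmtu]]] : exists2 t, t \in A7 & ~~ bad_rep 3 g true t /\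
    exists2 m, m \in fano_group true & m * t * u^-1 \in fano_group false.
  by case/orP: anti_u => /antiflagP-/(_ _ Au); [exists t1 | exists t2]; auto.
(* This element lies in both cosets of the antiflag, and by [fano_conjVM] the conditions depend only
   on the cosets. *)
exists (m * t) => [|i []]; first by rewrite groupM // (subsetP (fano_sub true)).
  rewrite fano_conjVM //; apply: contra good_t => Fg; apply/existsP; by exists i.
rewrite -[m * t](mulgKV u) fano_conjVM //.
by apply: contra good_u => Fg; apply/existsP; exists i.
Qed.

Lemma order7_spread3 (x s : 'S_7) : order7_in x s -> spread_class A7 (s ^: A7) 3.
Proof.
move=> o7 g ntg; have [Ax _] := o7; have [k Ak good_k] := good_conj g ntg.
have Axk : x^-1 * k \in A7 by rewrite groupM ?groupV.
exists (s ^ (x^-1 * k)) => [|i]; first exact: memJ_class.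
apply/eqP; apply: negbNE; have [_ Ag] := setD1P (ntg i); rewrite setUC.
rewrite (order7_gen_fano _ _ _ _ o7) // mulKVg negb_exists.
by apply/forallP=> b; apply: good_k.
Qed.

(** The four involutions defeat the classes of elements of order 7, and the four 3-cycles defeat all
    others. *)
Lemma no_spread4 (C : {set 'S_7}) : C \in classes A7 -> ~ spread_class A7 C 4.
Proof.
case/imsetP=> c Ac -> spr4.
have seqsP (ls : seq (seq nat)) :
    all even_nontrivial ls -> size ls = 4 ->
    exists2 h, h \in A7 & forall l, l \in ls ->
      <<[set c ^ h; seq_perm 6 l]>> = A7.
  move=> /allP ls_ok size_ls.
  have [i|s /imsetP[h Ah ->] gen_s] := spr4 (fun i => seq_perm 6 (nth [::] ls i)).
    have /ls_ok/and3P[perm_l ev_l nt_l] : nth [::] ls i \in ls.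
      by rewrite mem_nth // size_ls.
    by apply/setD1P; rewrite perm_eq1_code seq_permK // seq_perm_A7.
  exists h => // l ls_l; have lt_i : index l ls < 4 by rewrite -size_ls index_mem.
  by have := gen_s (Ordinal lt_i); rewrite /= nth_index // setUC.
have [[x o7]|[not7 _]] := order7_or_blocks c Ac.
  have [h Ah gen_h] := seqsP involutions isT erefl; have [Ax _] := o7.
  have /hasP[l ls_l] := allP involutions_cover _ (mem_even7 _ (groupM Ax Ah)).
  have /and3P[perm_l ev_l _] := allP (isT : all even_nontrivial involutions) l ls_l.
  have Al := seq_perm_A7 _ perm_l ev_l.
  have := order7_gen_fano _ _ _ _ o7 Ah Al; rewrite (gen_h l ls_l) eqxx.
  move/esym/negbT; rewrite negb_exists => /forallP fano'l.
  have codeE b : (seq_perm 6 l ^ (x * h)^-1 \in fano_group b)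
     = fano_aut b (conjseq l (code (x * h))).
    have AJ : seq_perm 6 l ^ (x * h)^-1 \in A7 by rewrite groupJ // groupV groupM.
    by rewrite fano_groupE // code_conjV seq_permK.
  by rewrite -!codeE (negPf (fano'l _)) (negPf (fano'l _)).
have [h Ah gen_h] := seqsP cycles3 isT erefl.
have Ach : c ^ h \in A7 by rewrite groupJ.
have [[x o7]|[_ [bs bl sw]]] := order7_or_blocks _ Ach.
  by case: not7; rewrite -(orderJ c h) (order7_order _ _ o7).
have /hasP[l ls_l /hasP[e bs_e /andP[/eqP f1 /eqP f2]]] := allP cycles3_blocks _ bl.
have /andP[/eqP s1 /eqP s2] := allP sw e bs_e.
have /and3P[perm_l ev_l _] := allP (isT : all even_nontrivial cycles3) l ls_l.
have [lt1 lt2] := block_lt _ _ bl bs_e.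
have : <<[set c ^ h; seq_perm 6 l]>> != A7.
  by apply: (@blocks_not_gen _ _ (Ordinal lt1) (Ordinal lt2)); apply: ord_inj;
    rewrite -nth_perm_seq ?seq_permK.
by rewrite gen_h ?eqxx.
Qed.

Lemma A7_spread : uniform_spread_eq A7 3.
Proof.
have o7 : order7_in 1 rot7 by split; rewrite ?group1 // conjg1.
split; last by case=> C; apply: no_spread4.
by exists (rot7 ^: A7); [apply: mem_classes rot7_A7 | apply: order7_spread3 o7].
Qed.

(** * The stabiliser of a Fano plane is PSL(2,7) *)

Lemma det_mx2 (R : comNzRingType) (A : 'M[R]_2) :
  (\det A = A 0 0 * A 1 1 - A 0 1 * A 1 0)%R.
Proof.
rewrite (expand_det_row _ 0%R) !big_ord_recl big_ord0 /cofactor !det_mx11 !mxE /=.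
rewrite expr0 expr1 addr0 mul1r mulN1r mulrN.
by congr (_ * A _ _ - A _ _ * A _ _)%R; apply: val_inj.
Qed.

Definition vec_nat (v : 'rV['F_7]_2) : nat * nat := (val (v 0 0), val (v 0 1))%R.
Definition mat_nat (A : 'M['F_7]_2) : (nat * nat) * (nat * nat) :=
  ((val (A 0 0), val (A 0 1)), (val (A 1 0), val (A 1 1)))%R.

Lemma val_F7_lt (x : 'F_7) : val x < 7. Proof. exact: (ltn_ord x). Qed.

Lemma vec_natM v A : vec_nat (v *m A)%R = mulvec (vec_nat v) (mat_nat A).
Proof.
rewrite /vec_nat !mxE !big_ord_recl !big_ord0 !addr0.
have -> : lift ord0 ord0 = 1%R :> 'I_2 by apply: val_inj.
by [].
Qed.

Lemma mem_vec7 v : (vec_nat v \in vec7) = (v != 0%R).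
Proof.
rewrite mem_vec7E !val_F7_lt !andbT; congr (~~ _).
apply/eqP/eqP=> [[v0 v1]|->]; last by rewrite /vec_nat !mxE.
apply/rowP=> i; rewrite mxE; apply: val_inj => /=.
by case: i => [[|[|//]] lt_i]; [rewrite -[RHS]v0 | rewrite -[RHS]v1];
  congr (val (v _ _)); apply: val_inj.
Qed.

Lemma vec7P w : w \in vec7 -> exists2 v : 'rV['F_7]_2, v != 0%R & vec_nat v = w.
Proof.
move=> vw; have := vw; rewrite mem_vec7E => /and3P[_ lt1 lt2].
pose v : 'rV['F_7]_2 := (\row_j if j == 0 then inZp w.1 else inZp w.2)%R.
have Dv : vec_nat v = w by rewrite /vec_nat !mxE /= !modn_small -?surjective_pairing.
by exists v; rewrite // -mem_vec7 Dv.
Qed.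

Definition twist (A : 'M['F_7]_2) i j := eq_compl (word i) (pull (mat_nat A) j).

(** The bit [e] records whether a complement is taken; such bits add up under composition. *)
Lemma twistP (A : 'M['F_7]_2) i j :
  reflect (exists e, forall v : 'rV['F_7]_2, v != 0%R ->
             qr_word i (vec_nat v) = e (+) qr_word j (vec_nat (v *m A)%R))
          (twist A i j).
Proof.
apply: (iffP idP) => [/orP[]/eqP eq_w | [e eq_e]].
- exists false => v; rewrite -mem_vec7 => v7.
  by rewrite vec_natM; move/eq_in_map: eq_w => /(_ _ v7).
- exists true => v; rewrite -mem_vec7 => v7; rewrite vec_natM.
  by move: eq_w; rewrite -map_comp => /eq_in_map/(_ _ v7).
have eqv w : w \in vec7 -> qr_word i w = e (+) qr_word j (mulvec w (mat_nat A)).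
  by case/vec7P=> v nzv <-; rewrite eq_e ?vec_natM.
by case: e {eq_e} eqv => eqv; apply/orP; [right | left]; apply/eqP;
  rewrite -?map_comp; apply/eq_in_map=> w /eqv.
Qed.

Lemma mulmx_unit_neq0 (A : 'M['F_7]_2) (v : 'rV['F_7]_2) :
  A \in unitmx -> v != 0%R -> (v *m A != 0)%R.
Proof.
move=> uA; apply: contraNneq => vA0.
by rewrite -[v](mulmxK uA) vA0 mul0mx.
Qed.

Lemma mulmx_unitP (A : 'M['F_7]_2) (v : 'rV['F_7]_2) : A \in unitmx -> v != 0%R ->
  exists2 u : 'rV['F_7]_2, u != 0%R & v = (u *m A)%R.
Proof.
move=> uA nzv; exists (v *m invmx A)%R; last by rewrite mulmxKV.
by apply: contraNneq nzv => vA0; rewrite -[v](mulmxKV uA) vA0 mul0mx.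
Qed.

Lemma word_inj (i j : 'I_7) e :
  (forall v : 'rV['F_7]_2, v != 0%R ->
     qr_word i (vec_nat v) = e (+) qr_word j (vec_nat v)) -> i = j.
Proof.
move=> eqw; apply/val_inj/eqP.
have /allP/(_ (val i)) := words_check; rewrite mem_iota ltn_ord => /(_ isT)/allP/(_ (val j)).
rewrite mem_iota ltn_ord => /(_ isT)/implyP; apply.
have eqv w : w \in vec7 -> qr_word i w = e (+) qr_word j w.
  by case/vec7P=> v nzv <-; apply: eqw.
by case: e {eqw} eqv => eqv; apply/orP; [right | left]; apply/eqP;
  rewrite -?map_comp; apply/eq_in_map=> w /eqv.
Qed.

Lemma twistM A B i j k : A \in unitmx ->
  twist A i j -> twist B j k -> twist (A *m B)%R i k.
Proof.
move=> uA /twistP[e eA] /twistP[f eB]; apply/twistP; exists (e (+) f) => v nzv.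
by rewrite eA // eB ?mulmx_unit_neq0 // addbA mulmxA.
Qed.

Lemma twist_uniql A (i i' : 'I_7) j : twist A i j -> twist A i' j -> i = i'.
Proof.
move=> /twistP[e eA] /twistP[f eA']; apply: (@word_inj _ _ (e (+) f)) => v nzv.
by rewrite eA // eA' // addbA addbK.
Qed.

Lemma twist_uniqr A i (j j' : 'I_7) : A \in unitmx ->
  twist A i j -> twist A i j' -> j = j'.
Proof.
move=> uA /twistP[e eA] /twistP[f eA']; apply: (@word_inj _ _ (e (+) f)) => v nzv.
have [u nzu ->] := mulmx_unitP _ _ uA nzv.
by rewrite -addbA -eA' // eA // addbA addbb.
Qed.

(** Junk value 1 if A does not permute the words up to complement. *)
Definition twist_perm (A : 'M['F_7]_2) : 'S_7 :=
  odflt 1 [pick p : 'S_7 | [forall i : 'I_7, twist A i (p i)]].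

Lemma twist_perm_eq A (p : 'S_7) : A \in unitmx ->
  (forall i : 'I_7, twist A i (p i)) -> twist_perm A = p.
Proof.
move=> uA Ap; rewrite /twist_perm; case: pickP => [q /forallP Aq | /(_ p)/forallP[] //].
by apply/permP=> i; apply: twist_uniqr uA (Aq i) (Ap i).
Qed.

Lemma mem_mat7 (A : 'M['F_7]_2) : (\det A = 1)%R -> mat_nat A \in mat7.
Proof.
rewrite det_mx2 => detA; apply: mem_mat7E; rewrite ?val_F7_lt //.
have : (A 0 0 * A 1 1 = A 0 1 * A 1 0 + 1)%R by rewrite -detA addrC subrK.
by move/(congr1 val) => /=; rewrite modnDml.
Qed.

Lemma twist_permP (A : 'M['F_7]_2) : (\det A = 1)%R ->
  forall i : 'I_7, twist A i (twist_perm A i).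
Proof.
move=> detA; have /andP[/allP ex_j _] := allP sl2_check _ (mem_mat7 _ detA).
have {}ex_j (i : 'I_7) : [exists j : 'I_7, twist A i j].
  have i7 : val i \in iota 0 7 by rewrite mem_iota ltn_ord.
  have /hasP[_ /mapP[j j7 ->] eq_w] := ex_j _ (map_f word i7).
  rewrite mem_iota /= in j7; apply/existsP; exists (Ordinal j7).
  exact: eq_w.
have uA : A \in unitmx by rewrite unitmxE detA unitr1.
pose f i := xchoose (existsP (ex_j i)).
have Af (i : 'I_7) : twist A i (f i) := xchooseP (existsP (ex_j i)).
have f_inj : injective f.
  by move=> i i' eqf; apply: twist_uniql (Af i) _; rewrite eqf.
have Ap (i : 'I_7) : twist A i (perm f_inj i) by rewrite permE.
by rewrite (twist_perm_eq _ _ uA Ap).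
Qed.

Lemma unitmx_det1 (A : 'M['F_7]_2) : (\det A = 1)%R -> A \in unitmx.
Proof. by move=> detA; rewrite unitmxE detA unitr1. Qed.

(** An invertible matrix permutes the nonzero vectors, and complementing words changes their sum by
    a constant. *)
Lemma line_pull A (i j k i' j' k' : 'I_7) : A \in unitmx ->
    twist A i i' -> twist A j j' -> twist A k k' ->
  is_const (sum3 i j k) -> is_const (sum3 i' j' k').
Proof.
move=> uA /twistP[e eA] /twistP[f fA] /twistP[g gA].
pose q (a b c : 'I_7) v := qr_word a v (+) qr_word b v (+) qr_word c v.
have constP a b c :
    reflect (exists x, forall v : 'rV['F_7]_2, v != 0%R ->
               q a b c (vec_nat v) = x)
                            (is_const (sum3 a b c)).
  apply: (iffP orP) => [[] /allP all_w | [x eq_x]].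
  - exists true => v; rewrite -mem_vec7 => v7.
    exact: all_w (map_f _ v7).
  - exists false => v; rewrite -mem_vec7 => v7; apply/negbTE.
    exact: all_w (map_f _ v7).
  by case: x eq_x => eq_x; [left | right]; apply/allP=> _ /mapP[w /vec7P[v nzv <-] ->];
    rewrite /= -/(q a b c _) eq_x.
case/constP=> x eq_x; apply/constP; exists (x (+) e (+) f (+) g) => v nzv.
have [u nzu ->] := mulmx_unitP _ _ uA nzv.
rewrite -(eq_x u nzu) /q eA // fA // gA //.
by move: (qr_word _ _) (qr_word _ _) (qr_word _ _) => [] [] [];
  case: e f g {eA fA gA} => [] [] [].
Qed.

Lemma third_line (i j k : 'I_7) : i != j ->
  is_const (sum3 i j k) = (val k == third true i j).
Proof.
move=> neq_ij; have i7 (l : 'I_7) : val l \in iota 0 7 by rewrite mem_iota ltn_ord.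
have /allP row_i := allP lines_check _ (i7 i); have := row_i _ (i7 j).
cbv beta; rewrite val_eqE (negPf neq_ij) => /andP[const3 /allP all3].
have uniq3 := implyP (all3 _ (i7 k)).
by apply/idP/eqP=> [/uniq3/eqP // | ->].
Qed.

Lemma third_diag (i : 'I_7) : third true i i = i.
Proof. by case: i => [[|[|[|[|[|[|[|]]]]]]]]. Qed.

Lemma twist_perm_fano A : (\det A = 1)%R -> twist_perm A \in fano_group true.
Proof.
move=> detA; have uA := unitmx_det1 _ detA; have Ap := twist_permP _ detA.
set p := twist_perm A in Ap *.
have aut_p : fano_aut true (code p).
  apply/fano_autP=> i j; have [->|neq_ij] := eqVneq i j.
    by rewrite third_diag; congr (val (p _)); apply: val_inj; rewrite /= third_diag.
  apply/esym/eqP; rewrite -third_line ?(inj_eq perm_inj) //.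
  by apply: line_pull uA (Ap _) (Ap _) (Ap _) _; rewrite third_line.
have Ap7 : p \in A7.
  rewrite Alt_even odd_perm_seq; apply: contraL aut_p => odd_p.
  by apply: (allP fano_even_check); rewrite mem_filter odd_p mem_perm_seqs.
by rewrite fano_groupE.
Qed.

(** * The homomorphism from SL(2,7) onto the stabiliser of the plane [fano true] *)

Definition sl_perm (u : {'GL_2['F_7]}) : 'S_7 := twist_perm (GLval u).

Lemma SL_det (u : {'GL_2['F_7]}) : u \in SL 2 'F_7 -> (\det (GLval u) = 1)%R.
Proof. by rewrite inE => /eqP. Qed.

Lemma sl_permM : {in SL 2 'F_7 &, {morph sl_perm : u v / u * v}}.
Proof.
move=> u v /SL_det du /SL_det dv; have uu := unitmx_det1 _ du.
apply: twist_perm_eq => [|i]; rewrite GL_ME.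
  by rewrite unitmx_det1 // det_mulmx du dv mulr1.
by rewrite permM; apply: (twistM _ _ _ (sl_perm u i)) => //; apply: twist_permP.
Qed.
Canonical sl_perm_morphism := Morphism sl_permM.

#[local] Opaque twist_perm.

Lemma SL_exists (A : 'M['F_7]_2) : (\det A = 1)%R ->
  exists2 u : {'GL_2['F_7]}, u \in SL 2 'F_7 & GLval u = A.
Proof.
move=> detA; pose u : {'GL_2['F_7]} := insubd (1 : {'GL_2['F_7]}) A.
have Du : GLval u = A by apply: insubdK; apply: unitmx_det1.
by exists u; rewrite // inE Du detA.
Qed.

Definition nat_mat (m : (nat * nat) * (nat * nat)) : 'M['F_7]_2 :=
  (\matrix_(i, j) inZp (let r := if i == 0 then m.1 else m.2 in
                        if j == 0 then r.1 else r.2))%R.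

Lemma mat_natK A : nat_mat (mat_nat A) = A.
Proof.
apply/matrixP=> i j; rewrite !mxE; apply: val_inj.
by case: i j => [[|[|//]] lt_i] [[|[|//]] lt_j]; rewrite /= modn_small ?val_F7_lt //;
  congr (val (A _ _)); apply: val_inj.
Qed.

Lemma sl_perm_image m l : is_perm_seq 7 l -> (\det (nat_mat m) = 1)%R ->
  mat_nat (nat_mat m) = m -> twist_seq m l -> seq_perm 6 l \in sl_perm @* SL 2 'F_7.
Proof.
move=> perm_l det_m eq_m tw_l; have [u SLu Du] := SL_exists _ det_m.
suff <- : sl_perm u = seq_perm 6 l by apply: mem_morphim.
rewrite /sl_perm Du; apply: twist_perm_eq => [|i]; first exact: unitmx_det1.
rewrite -nth_perm_seq seq_permK // /twist eq_m.
by apply: (allP tw_l); rewrite mem_iota ltn_ord.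
Qed.

Lemma rot7_image : rot7 \in sl_perm @* SL 2 'F_7.
Proof.
apply: (@sl_perm_image ((1, 0), (1, 1))%N _ _ _ _ twist_seq_shift7) => //.
  by rewrite det_mx2 !mxE; apply: val_inj.
by rewrite /mat_nat !mxE.
Qed.

Lemma double7_image : seq_perm 6 double7 \in sl_perm @* SL 2 'F_7.
Proof.
apply: (@sl_perm_image ((3, 0), (0, 5))%N _ _ _ _ twist_seq_double7) => //.
  by rewrite det_mx2 !mxE; apply: val_inj.
by rewrite /mat_nat !mxE.
Qed.

Lemma weyl7_image : seq_perm 6 weyl7 \in sl_perm @* SL 2 'F_7.
Proof.
apply: (@sl_perm_image ((0, 1), (6, 0))%N _ _ _ _ twist_seq_weyl7) => //.
  by rewrite det_mx2 !mxE; apply: val_inj.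
by rewrite /mat_nat !mxE.
Qed.

(** The Bruhat decomposition writes every element of the stabiliser in the shift, the doubling and
    the Weyl element, all of which are images. *)
Lemma sl_perm_im : sl_perm @* SL 2 'F_7 = fano_group true.
Proof.
apply/eqP; rewrite eqEsubset; apply/andP; split; apply/subsetP=> x.
  by case/morphimP=> u _ SLu ->; apply/twist_perm_fano/SL_det.
move=> Fx; have Ax := subsetP (fano_sub true) x Fx.
have im1 l : l \in borel_seqs -> exists2 y, y \in sl_perm @* SL 2 'F_7 & code y = l.
  case/allpairsP=> [[i k] [_ _ ->]].
  exists (rot7 ^+ i * seq_perm 6 double7 ^+ k).
    by rewrite groupM ?groupX ?rot7_image ?double7_image.
  by rewrite perm_seqM !perm_seqX code_rot7 seq_permK.
suff [y Gy /perm_seq_inj <- //] :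
    exists2 y, y \in sl_perm @* SL 2 'F_7 & code y = code x.
have : code x \in bruhat_seqs.
  by apply: (allP bruhat_check); rewrite mem_filter -fano_groupE // Fx mem_even7.
rewrite mem_cat => /orP[/im1 // | /allpairsP[[l j] [/im1[y Gy Dy] _ ->]]].
exists (y * seq_perm 6 weyl7 * rot7 ^+ j).
  by rewrite !groupM ?groupX ?rot7_image ?weyl7_image.
by rewrite !perm_seqM perm_seqX code_rot7 Dy (@seq_permK 6 weyl7).
Qed.

(** An element fixing every word is scalar, hence central. Conversely, the image of a central
    element commutes with the shift and the doubling, hence is trivial. *)
Lemma sl_perm_ker : 'ker sl_perm = 'Z(SL 2 'F_7).
Proof.
apply/eqP; rewrite eqEsubset; apply/andP; split; apply/subsetP=> u.
  case/morphpreP=> SLu /set1P/= u1; have detu := SL_det _ SLu.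
  have tw (i : 'I_7) : twist (GLval u) i i.
    have := twist_permP _ detu i; rewrite -/(sl_perm u) u1 perm1; exact.
  have /andP[_ /implyP scal] := allP sl2_check _ (mem_mat7 _ detu).
  have [a Du] : exists a, GLval u = (a%:M)%R.
    have /orP[] : (mat_nat (GLval u) == ((1, 0), (0, 1))%N)
               || (mat_nat (GLval u) == ((6, 0), (0, 6))%N).
      apply: scal; apply/allP=> i i7; move: (i7); rewrite mem_iota => lt_i.
      rewrite (nth_map 0%N) ?size_iota // (nth_map 0%N) ?size_iota // nth_iota // add0n.
      exact: tw (Ordinal lt_i).
    - move/eqP=> eq_m; exists 1%R; rewrite -[LHS]mat_natK eq_m.
      by apply/matrixP=> [[[|[|//]] ?] [[|[|//]] ?]]; rewrite !mxE; apply: val_inj.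
    move/eqP=> eq_m; exists (inZp 6); rewrite -[LHS]mat_natK eq_m.
    by apply/matrixP=> [[[|[|//]] ?] [[|[|//]] ?]]; rewrite !mxE; apply: val_inj.
  apply/setIP; split=> //; apply/centP=> v SLv; apply: val_inj.
  by rewrite -![val _]/(GLval _) !GL_MxE Du scalar_mxC.
case/setIP=> SLu /centP cent_u; apply/morphpreP; split=> //; apply/set1P.
have comm x : x \in sl_perm @* SL 2 'F_7 -> sl_perm u * x = x * sl_perm u.
  case/morphimP=> v _ SLv ->.
  apply: etrans (esym (sl_permM u v SLu SLv)) (etrans _ (sl_permM v u SLv SLu)).
  exact: congr1 (cent_u v SLv).
apply/eqP; rewrite perm_eq1_code.
have /implyP := allP center_check _ (mem_perm_seqs _ (sl_perm u)); apply.
rewrite -code_rot7 -(@seq_permK 6 double7) // -!perm_seqM.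
by rewrite !comm ?rot7_image ?double7_image ?eqxx.
Qed.

Lemma fano_PSL b : fano_group b \isog PSL 2 'F_7.
Proof.
have isoT : fano_group true \isog PSL 2 'F_7.
  rewrite isog_sym /PSL.
  have : SL 2 'F_7 / 'ker sl_perm \isog sl_perm @* SL 2 'F_7 := first_isog _.
  by rewrite sl_perm_im sl_perm_ker.
case: b => //; apply: isog_trans isoT; rewrite isog_sym.
(* The reflection x -> -x is odd: it conjugates one stabiliser to the other in S7 and normalises
   A7. *)
suff -> : fano_group false = (fano_group true :^ reflect7)%G by apply: conj_isog.
apply/group_inj/setP=> g; rewrite mem_conjg.
have memA : (g ^ reflect7^-1 \in A7) = (g \in A7).
  by rewrite memJ_norm // (subsetP (Alt_norm _)) ?inE.
have [Ag|A'g] := boolP (g \in A7); last first.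
  have -> : (g \in fano_group false) = false.
    by apply: contraNF A'g; apply: (subsetP (fano_sub false)).
  apply/esym; apply: contraNF A'g => /(subsetP (fano_sub true)).
  by rewrite memA.
rewrite !fano_groupE ?memA // code_conjV seq_permK //.
by have /eqP-> := allP reflect_check _ (mem_even7 _ Ag).
Qed.

Theorem mainTheorem6 :
  let S : {group {perm 'I_7}} := Alt_group 'I_7 in
  [/\ (* (a) *)
      sigma_min S = (2 / 5)%R /\
      (forall s, s \in S^# -> sigma_at S s = (2 / 5)%R <-> #[s] = 7),
      (* (b) *)
      (forall s, s \in S -> #[s] = 7 ->
       exists M1 M2 : {group {perm 'I_7}},
         [/\ max_subgroups_containing S s = [set M1; M2],
             (forall x, x \in S -> M1 :^ x <> M2),
             M1 \isog PSL 2 'F_7 & M2 \isog PSL 2 'F_7]),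
      (* (c) *)
      P_min S = (2 / 5)%R /\
      (forall s, s \in S^# -> P_at S s = (2 / 5)%R <-> #[s] = 7) &
      (* (d) *)
      uniform_spread_eq S 3 /\
      (forall s, s \in S -> #[s] = 7 -> spread_class S (s ^: S) 3)].
Proof.
move=> S; have [sigma_min7 P_min7] := sigma_P_min.
split.
- by split=> // s As; have [] := sigma_P_order7 s As.
- move=> s As /(order7P _ As)[x o7]; have [Ax _] := o7.
  exists (fano_group true :^ x)%G, (fano_group false :^ x)%G; split.
  + exact: max_subgroups_order7.
  + by move=> y Sy; rewrite -conjsgM; apply: fano_not_conj; rewrite ?groupM.
  + by apply: isog_trans (fano_PSL true); rewrite isog_sym conj_isog.
  by apply: isog_trans (fano_PSL false); rewrite isog_sym conj_isog.
- by split=> // s As; have [] := sigma_P_order7 s As.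
split; first exact: A7_spread.
by move=> s As /(order7P _ As)[x o7]; apply: order7_spread3 o7.
Qed.
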